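(* Let $d\ge 2$ be an integer, $\lambda>0$, let $\kappa$ be a nonnegative integer, let $f$ be a several times continuously differentiable function on $\mathbb{B}^d$, and let $u\in H_0^1(\mathbb{B}^d)$ be the solution of the Dirichlet problem $-\Delta u+\lambda(1-\|x\|^2)^\kappa u=f$ in $\mathbb{B}^d$, $u=0$ on $\mathbb{S}^{d-1}$, in its variational formulation $$\int_{\mathbb{B}^d}\big[\nabla u\cdot\nabla v+\lambda\,u\,v\,(1-\|x\|^2)^\kappa\big]dx=\int_{\mathbb{B}^d}f\,v\,dx\qquad\text{for all } v\in H_0^1(\mathbb{B}^d).$$ Let $$\widehat{u}_{j,\nu}^{\,n}=\frac{\langle u,(1-\|x\|^2)R_{j,\nu}^n\rangle_{\nabla,\mathbb{B}^d}}{\|(1-\|x\|^2)R_{j,\nu}^n\|_{\nabla,\mathbb{B}^d}^2},\qquad \widetilde f_{j,\nu}^{\,n}=\widehat{u}_{j,\nu}^{\,n}\,\|(1-\|x\|^2)R_{j,\nu}^n\|_{\nabla,\mathbb{B}^d}^2 .$$ Then for all $n\ge 0$, $0\le j\le\lfloor n/2\rfloor$ and $1\le\nu\le a_{n-2j}^d$, $$\widetilde f_{j,\nu}^{\,n}=\int_{\mathbb{B}^d}f(x)\,(1-\|x\|^2)\,R_{j,\nu}^n(x)\,dx ,$$ and for all $n\ge 0$, $0\le k\le\lfloor n/2\rfloor$ and $1\le\nu\le a_{n-2k}^d$, with $\beta=n-2k+\frac{d-2}{2}$, these numbers satisfy the recursion $$\widehat f_{k,\nu}^{\,n,1}\,H_{k,n}^1=\widetilde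 f_{k,\nu}^{\,n}+\sum_{j=\max(0,\,k-(\kappa+1))}^{k-1}a_{k,j}^{(\beta)}\,\widetilde f_{j,\nu}^{\,n-2(k-j)} .$$
   Context: $\mathbb{B}^d$ is the closed unit ball of $\mathbb{R}^d$ and $\mathbb{S}^{d-1}$ its boundary sphere. $\mathcal{H}_\ell^d$ is the space of harmonic homogeneous polynomials of degree $\ell$ in $d$ variables, $a_\ell^d=\dim\mathcal{H}_\ell^d$, and for each $\ell\ge0$ a basis $\{Y_\nu^\ell:1\le\nu\le a_\ell^d\}$ of $\mathcal{H}_\ell^d$, orthonormal with respect to $\frac{1}{\omega_d}\int_{\mathbb{S}^{d-1}}f g\,d\sigma$ ($\omega_d$ the surface area of $\mathbb{S}^{d-1}$), is fixed. $P_k^{(\alpha,\beta)}$ is the Jacobi polynomial of degree $k$, orthogonal on $[-1,1]$ for the weight $(1-t)^\alpha(1+t)^\beta$ and normalized by $P_k^{(\alpha,\beta)}(1)=\binom{k+\alpha}{k}$. For $\beta>-1$, $$(g,h)_\beta=\frac{\lambda}{2^{\kappa+3}}\int_{-1}^1 g(t)h(t)(1-t)^{\kappa+2}(1+t)^{\beta}dt+\int_{-1}^1\frac{d}{dt}\big((1-t)g(t)\big)\frac{d}{dt}\big((1-t)h(t)\big)(1+t)^{\beta+1}dt ,$$ $q_k^{(\beta)}$ ($k\ge0$) are the polynomials of degree $k$ orthogonal with respect to $(\cdot,\cdot)_\beta$ with the same leading coefficient as $P_k^{(1,\beta)}$, and $a_{k,j}^{(\beta)}=(P_k^{(1,\beta)},q_j^{(\beta)})_\beta/(q_j^{(\beta)},q_j^{(\beta)})_\beta$.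 For $0\le j\le \lfloor n/2\rfloor$ define $$R_{j,\nu}^n(x)=q_j^{(n-2j+\frac{d-2}{2})}(2\|x\|^2-1)\,Y_\nu^{n-2j}(x),\qquad P_{j,\nu}^{n,1}(x)=P_j^{(1,\,n-2j+\frac{d-2}{2})}(2\|x\|^2-1)\,Y_\nu^{n-2j}(x).$$ The Sobolev inner product is $\langle g,h\rangle_{\nabla,\mathbb{B}^d}=\lambda\int_{\mathbb{B}^d}g\,h\,(1-\|x\|^2)^\kappa dx+\int_{\mathbb{B}^d}\nabla g\cdot\nabla h\,dx$, with norm $\|\cdot\|_{\nabla,\mathbb{B}^d}$. Furthermore $b_1=\big(\int_{\mathbb{B}^d}(1-\|x\|^2)dx\big)^{-1}$, $\langle g,h\rangle_1=b_1\int_{\mathbb{B}^d}g\,h\,(1-\|x\|^2)dx$, $H_{k,n}^1=\langle P_{k,\nu}^{n,1},P_{k,\nu}^{n,1}\rangle_1$ (which does not depend on $\nu$), and $\widehat f_{k,\nu}^{\,n,1}=\langle f,P_{k,\nu}^{n,1}\rangle_1/H_{k,n}^1$ is the Fourier coefficient of $f$ in the basis of classical ball polynomials $P_{k,\nu}^{n,1}$.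
   Formalization: The recursion is proved with the right-hand side multiplied by b_1; as printed it fails because the left side carries the normalization b_1 and the right side does not (e.g. f = 1, n = k = 0, d = 2 gives 1 versus pi/2). *)

(* Defs.v *)
From HB Require Import structures.
From mathcomp Require Import all_boot all_order all_algebra.
From mathcomp Require Import -(notations) mpoly.
From mathcomp Require Import all_classical all_reals all_analysis.
From mathcomp Require Import measurable_realfun.

Set Implicit Arguments.
Unset Strict Implicit.
Unset Printing Implicit Defensive.
Import Order.TTheory GRing.Theory Num.Theory.
Import numFieldNormedType.Exports.
Local Open Scope classical_set_scope.
Local Open Scope ring_scope.

Definition rV_display : measure_display.
Proof. exact: default_measure_display. Qed.

Section rV_measurable.
Context {R : realType} (n : nat).

Let coors : 'I_n -> 'rV[R]_n -> measurableTypeR R := fun i x => x 0 i.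

Let rV_set0 : g_sigma_preimage coors set0.
Proof. exact: sigma_algebra0. Qed.

Let rV_setC A : g_sigma_preimage coors A -> g_sigma_preimage coors (~` A).
Proof. exact: sigma_algebraC. Qed.

Let rV_bigcup (F : _^nat) : (forall i, g_sigma_preimage coors (F i)) ->
  g_sigma_preimage coors (\bigcup_i (F i)).
Proof. exact: sigma_algebra_bigcup. Qed.

(* The product (equivalently, Borel) sigma-algebra of R^n, generated by the
   coordinate maps, as the library does for tuples. *)
HB.instance Definition _ := @isMeasurable.Build rV_display
  'rV[R]_n (g_sigma_preimage coors) rV_set0 rV_setC rV_bigcup.

End rV_measurable.

Section rV_lebesgue.
Context {R : realType}.

Lemma measurable_coord n (i : 'I_n) :
  measurable_fun [set: 'rV[R]_n] (fun x : 'rV[R]_n => x 0 i : measurableTypeR R).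
Proof.
move=> _ Y mY; rewrite setTI; apply: sub_sigma_algebra => /=.
rewrite -bigcup_seq/=; exists i => /=; first by rewrite mem_index_enum.
by exists Y => //; rewrite setTI.
Qed.

Lemma measurable_rV d (T : measurableType d) n (f : T -> 'rV[R]_n) :
  (forall i, measurable_fun setT (fun t => f t 0 i : measurableTypeR R)) ->
  measurable_fun setT f.
Proof.
move=> mf.
suff : g_sigma_preimage (fun i t => f t 0 i : measurableTypeR R) `<=` measurable.
  have /= -> := g_sigma_preimage_comp
    (fun (i : 'I_n) (x : 'rV[R]_n) => x 0 i : measurableTypeR R) f.
  by move=> sub _ A mA; apply: sub; exists A.
apply: smallest_sub; first exact: sigma_algebra_measurable.
case: n f mf => [|n] f mf; first by rewrite big_ord0.
rewrite -bigcup_mkord_ord; apply: bigcup_sub => i Ii.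
by move=> A [B mB <-]; exact: mf.
Qed.

Definition rV_cons n (p : measurableTypeR R * 'rV[R]_n) : 'rV[R]_n.+1 :=
  row_mx (p.1%:M : 'rV[R]_1) p.2.

Definition rV_uncons n (x : 'rV[R]_n.+1) : measurableTypeR R * 'rV[R]_n :=
  (x 0 ord0, \row_j x 0 (lift ord0 j)).

Lemma rV_consE0 n p : @rV_cons n p 0 ord0 = p.1.
Proof.
rewrite /rV_cons; have -> : ord0 = lshift n (ord0 : 'I_1) by exact: val_inj.
by rewrite (row_mxEl (p.1%:M : 'rV_1)) mxE eqxx.
Qed.

Lemma rV_consES n p j : @rV_cons n p 0 (lift ord0 j) = p.2 0 j.
Proof.
rewrite /rV_cons; have -> : lift ord0 j = rshift 1 j by exact: val_inj.
by rewrite (row_mxEr (p.1%:M : 'rV_1)).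
Qed.

Lemma rV_consK n : cancel (@rV_cons n) (@rV_uncons n).
Proof.
move=> [t x]; rewrite /rV_uncons rV_consE0; congr pair.
by apply/rowP => j; rewrite mxE rV_consES.
Qed.

Lemma measurable_rV_cons n : measurable_fun setT (@rV_cons n).
Proof.
apply: measurable_rV => i; case: (unliftP ord0 i) => [j ->|->].
- under eq_fun do rewrite rV_consES.
  exact: (measurableT_comp (measurable_coord j) measurable_snd).
- under eq_fun do rewrite rV_consE0.
  exact: measurable_fst.
Qed.

Lemma measurable_rV_uncons n : measurable_fun setT (@rV_uncons n).
Proof.
apply/measurable_fun_pairP; split; first exact: measurable_coord.
apply: measurable_rV => i; rewrite /rV_uncons /=.
under eq_fun do rewrite mxE.
exact: measurable_coord.
Qed.

HB.instance Definition _ n := isMeasurableFun.Build _ _ _ _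
  (@rV_cons n) (@measurable_rV_cons n).

Section lebesgue_cons.
Variables (n : nat) (mu : {sigma_finite_measure set 'rV[R]_n -> \bar R}).

Definition lebesgue_cons : set 'rV[R]_n.+1 -> \bar R :=
  pushforward (lebesgue_measure \x mu)%E (@rV_cons n).

Let lebesgue_cons0 : lebesgue_cons set0 = 0%E.
Proof. exact: measure0. Qed.

Let lebesgue_cons_ge0 A : (0 <= lebesgue_cons A)%E.
Proof. exact: measure_ge0. Qed.

Let lebesgue_cons_sigma_additive : semi_sigma_additive lebesgue_cons.
Proof. exact: measure_semi_sigma_additive. Qed.

HB.instance Definition _ := isMeasure.Build _ _ _ lebesgue_cons
  lebesgue_cons0 lebesgue_cons_ge0 lebesgue_cons_sigma_additive.

Let lebesgue_cons_sigma_finite : sigma_finite setT lebesgue_cons.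
Proof.
have /sigma_finiteP[F [FT ndF Foo]] :=
  sigma_finiteT (lebesgue_measure : set (measurableTypeR R) -> \bar R).
have /sigma_finiteP[G [GT ndG Goo]] := sigma_finiteT mu.
exists (fun i => @rV_uncons n @^-1` (F i `*` G i)).
  rewrite -preimage_bigcup (_ : \bigcup_i _ = setT) ?preimage_setT//.
  rewrite -subTset => -[t x] _.
  have [k _ Fk] : (\bigcup_i F i) t by rewrite -FT.
  have [l _ Gl] : (\bigcup_i G i) x by rewrite -GT.
  exists (maxn k l) => //; split => /=.
    by move: Fk; exact/subsetPset/ndF/leq_maxl.
  by move: Gl; exact/subsetPset/ndG/leq_maxr.
move=> i; have [mF Fi] := Foo i; have [mG Gi] := Goo i.
have mFG : measurable (F i `*` G i) by exact: measurableX.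
split; first by rewrite -[X in measurable X]setTI; exact: measurable_rV_uncons.
rewrite /lebesgue_cons /pushforward -comp_preimage.
rewrite (_ : @rV_uncons n \o @rV_cons n = id); last first.
  by apply/funext => p /=; rewrite rV_consK.
by rewrite preimage_id product_measure1E// lte_mul_pinfty// ge0_fin_numE.
Qed.

HB.instance Definition _ := Measure_isSigmaFinite.Build _ _ _
  lebesgue_cons lebesgue_cons_sigma_finite.

End lebesgue_cons.

(* Lebesgue measure on R^n: the point mass for n = 0, and the image of the
   product of Lebesgue measure on R and on R^n under (t, x) |-> (t, x_1 .. x_n)
   for n.+1. *)
Fixpoint lebesgue_rV (n : nat) : {sigma_finite_measure set 'rV[R]_n -> \bar R} :=
  match n with
  | 0%N => \d_(0 : 'rV[R]_0)
  | m.+1 => lebesgue_cons (lebesgue_rV m)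
  end.

End rV_lebesgue.

Section ball.
Context {R : realType} (d : nat).
Implicit Types (x y : 'rV[R]_d) (f g h u v : 'rV[R]_d -> R).

Definition dot x y : R := \sum_(i < d) x 0 i * y 0 i.

(* The norm the library puts on ['rV_d] is the sup norm; this is the Euclidean
   one. *)
Definition enorm x : R := Num.sqrt (dot x x).

Definition Ball : set 'rV[R]_d := [set x | enorm x <= 1].
Definition openBall : set 'rV[R]_d := [set x | enorm x < 1].
Definition Sphere : set 'rV[R]_d := [set x | enorm x = 1].

Definition int_ball f : R := \int[lebesgue_rV d]_(x in Ball) f x.

Lemma measurable_dot_diag :
  measurable_fun [set: 'rV[R]_d] (fun x => dot x x : R).
Proof.
rewrite /dot; apply: measurable_sum => i.
by apply: measurable_funM; exact: measurable_coord.
Qed.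

Lemma measurable_enorm : measurable_fun [set: 'rV[R]_d] (enorm : _ -> R).
Proof.
apply: measurableT_comp; last exact: measurable_dot_diag.
apply: continuous_measurable_fun; exact: sqrt_continuous.
Qed.

Lemma measurable_Ball : measurable Ball.
Proof.
rewrite (_ : Ball = enorm @^-1` `]-oo, 1]%classic).
  by rewrite -[X in measurable X]setTI; exact: measurable_enorm.
by apply/seteqP; split=> x /=; rewrite in_itv.
Qed.

Definition radial_proj x : 'rV[R]_d := (enorm x)^-1 *: x.

Lemma measurable_radial_proj : measurable_fun [set: 'rV[R]_d] radial_proj.
Proof.
apply: measurable_rV => i; under eq_fun do rewrite mxE.
apply: measurable_funM; last exact: measurable_coord.
under eq_fun do rewrite -powR_inv1 ?sqrtr_ge0//.
exact: (measurableT_comp (measurable_powR _) measurable_enorm).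
Qed.

HB.instance Definition _ := isMeasurableFun.Build _ _ _ _
  radial_proj measurable_radial_proj.

(* A |-> |{x in B : x / |x| in A}|; the origin (sent to 0) is a null set. *)
Definition cone_measure : set 'rV[R]_d -> \bar R :=
  pushforward (mrestr (lebesgue_rV d) measurable_Ball) radial_proj.

Let cone_measure0 : cone_measure set0 = 0%E.
Proof. exact: measure0. Qed.

Let cone_measure_ge0 A : (0 <= cone_measure A)%E.
Proof. exact: measure_ge0. Qed.

Let cone_measure_sigma_additive : semi_sigma_additive cone_measure.
Proof. exact: measure_semi_sigma_additive. Qed.

HB.instance Definition _ := isMeasure.Build _ _ _ cone_measure
  cone_measure0 cone_measure_ge0 cone_measure_sigma_additive.

(* By polar coordinates, the surface measure of the unit sphere is d times the
   cone measure. *)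
Definition surface_measure : set 'rV[R]_d -> \bar R :=
  mscale (d%:R%:nng : {nonneg R}) cone_measure.

HB.instance Definition _ := Measure.on surface_measure.

Definition sphere_area : R := fine (surface_measure Sphere).

Definition axis (i : 'I_d) : 'rV[R]_d := delta_mx 0 i.

(* [f] is C^k on [D]: for a closed domain, the partial derivatives taken in the
   interior extend continuously to [D]. *)
Fixpoint cont_diff (k : nat) (D : set 'rV[R]_d) f : Prop :=
  {within D, continuous f} /\
  match k with
  | 0%N => True
  | l.+1 => forall i, exists2 g : 'rV[R]_d -> R,
      (forall x, (D°) x -> is_derive x (axis i) f (g x)) & cont_diff l D g
  end.

(* C_c^infty functions on the open ball, extended by 0 to R^d; the closed support
   is bounded, hence compact. *)
Definition test_function f : Prop :=
  (forall k, cont_diff k setT f) /\ closure [set x | f x != 0] `<=` openBall.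

Definition grad f x : 'rV[R]_d := \row_i 'D_(axis i) f x.

(* Elements of L^2 are represented by Borel functions. *)
Definition L2_ball f : Prop :=
  measurable_fun Ball f /\
  (lebesgue_rV d).-integrable Ball (fun x => (f x ^+ 2)%:E).

Definition weak_gradient u (G : 'rV[R]_d -> 'rV[R]_d) : Prop :=
  (forall i, L2_ball (fun x => G x 0 i)) /\
  forall phi, test_function phi -> forall i,
    int_ball (fun x => u x * 'D_(axis i) phi x) =
    - int_ball (fun x => G x 0 i * phi x).

(* H^1_0 is the closure of C_c^infty in H^1. *)
Definition H1_0 u : Prop :=
  L2_ball u /\
  exists (G : 'rV[R]_d -> 'rV[R]_d) (phi : nat -> 'rV[R]_d -> R),
    [/\ weak_gradient u G,
        forall m, test_function (phi m) &
        int_ball (fun x => (u x - phi m x) ^+ 2 +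
          dot (G x - grad (phi m) x) (G x - grad (phi m) x)) @[m --> \oo]
          --> (0 : R)].

(* A weak gradient of [u], unique almost everywhere on the ball; the dummy value
   0 is used when [u] has none. *)
Definition wgrad u : 'rV[R]_d -> 'rV[R]_d :=
  xget (cst 0) [set G | weak_gradient u G].

Definition bubble x : R := 1 - enorm x ^+ 2.

Definition sobolev_ip (lam : R) (kap : nat) g h : R :=
  lam * int_ball (fun x => g x * h x * bubble x ^+ kap) +
  int_ball (fun x => dot (wgrad g x) (wgrad h x)).

Definition sobolev_norm (lam : R) (kap : nat) g : R :=
  Num.sqrt (sobolev_ip lam kap g g).

(* The weak solution of - Delta u + lam (1 - |x|^2)^kap u = f, u = 0 on the
   sphere. *)
Definition weak_solution (lam : R) (kap : nat) f u : Prop :=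
  H1_0 u /\ forall v, H1_0 v ->
    int_ball (fun x => dot (wgrad u x) (wgrad v x)
                       + lam * u x * v x * bubble x ^+ kap) =
    int_ball (fun x => f x * v x).

Definition mpoly_at (p : mpoly d R) x : R := meval (fun i => x 0 i) p.

Definition harmonic_homog (l : nat) (p : mpoly d R) : Prop :=
  p \is @ishomog1 d R l mdeg /\ \sum_(i < d) mderiv i (mderiv i p) = 0.

Definition sphere_ip (p r : mpoly d R) : R :=
  sphere_area^-1 *
  \int[surface_measure]_(x in Sphere) (mpoly_at p x * mpoly_at r x).

(* [Y 1, ..., Y a] is an orthonormal basis of the harmonic homogeneous
   polynomials of degree [l]; in particular [a] is their dimension. *)
Definition harmonic_onb (l a : nat) (Y : nat -> mpoly d R) : Prop :=
  [/\ forall nu, (1 <= nu <= a)%N -> harmonic_homog l (Y nu),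
      forall nu mu, (1 <= nu <= a)%N -> (1 <= mu <= a)%N ->
        sphere_ip (Y nu) (Y mu) = (nu == mu)%:R &
      forall p, harmonic_homog l p ->
        exists c : nat -> R, p = \sum_(1 <= nu < a.+1) c nu *: Y nu].

End ball.

Arguments Ball {R d} _.
Arguments openBall {R d} _.
Arguments Sphere {R d} _.

Section univariate.
Context {R : realType}.
Implicit Types (alpha beta lam x : R) (kap k : nat) (P q : nat -> {poly R}).

Definition int_pm1 (f : R -> R) : R := \int[lebesgue_measure]_(t in `[(-1), 1]) f t.

Definition gen_binom x k : R := (\prod_(i < k) (x - i%:R)) / k`!%:R.

Definition jacobi_family alpha beta P : Prop :=
  [/\ forall k, size (P k) = k.+1,
      forall j k, j <> k ->
        int_pm1 (fun t => (P j).[t] * (P k).[t] *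
          (1 - t) `^ alpha * (1 + t) `^ beta) = 0 &
      forall k, (P k).[1] = gen_binom (k%:R + alpha) k].

(* The derivatives are those of the polynomials (1 - t) g and (1 - t) h. *)
Definition univ_ip lam kap beta (g h : {poly R}) : R :=
  lam / 2 ^+ (kap + 3) *
    int_pm1 (fun t => g.[t] * h.[t] * (1 - t) ^+ (kap + 2) * (1 + t) `^ beta) +
  int_pm1 (fun t => ((1 - 'X) * g)^`().[t] * ((1 - 'X) * h)^`().[t] *
    (1 + t) `^ (beta + 1)).

(* q_k has degree k and the leading coefficient of P_k^(1, beta). *)
Definition univ_family lam kap beta P q : Prop :=
  [/\ forall k, size (q k) = k.+1,
      forall j k, j <> k -> univ_ip lam kap beta (q j) (q k) = 0 &
      forall k, lead_coef (q k) = lead_coef (P k)].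

Definition conn_coef lam kap beta P q (k j : nat) : R :=
  univ_ip lam kap beta (P k) (q j) / univ_ip lam kap beta (q j) (q j).

End univariate.

Section ball_polynomials.
Context {R : realType} (d : nat) (lam : R) (kap : nat).
Implicit Types (p q P : R -> nat -> {poly R}) (Y : nat -> nat -> mpoly d R).
Implicit Types (f g h u : 'rV[R]_d -> R) (n j k nu : nat).

Definition beta_of n j : R := (n - 2 * j)%:R + (d%:R - 2) / 2.

(* R_{j,nu}^n for the family [q], P_{j,nu}^{n,1} for the Jacobi family. *)
Definition ball_poly p Y n j nu (x : 'rV[R]_d) : R :=
  (p (beta_of n j) j).[2 * enorm x ^+ 2 - 1] * mpoly_at (Y (n - 2 * j)%N nu) x.

Definition sob_poly q Y n j nu (x : 'rV[R]_d) : R :=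
  bubble x * ball_poly q Y n j nu x.

Definition uhat q Y u n j nu : R :=
  sobolev_ip lam kap u (sob_poly q Y n j nu) /
  sobolev_norm lam kap (sob_poly q Y n j nu) ^+ 2.

Definition ftilde q Y u n j nu : R :=
  uhat q Y u n j nu * sobolev_norm lam kap (sob_poly q Y n j nu) ^+ 2.

Definition b1 : R := (int_ball (fun x : 'rV[R]_d => bubble x))^-1.

(* [ip1] carries the normalization [b1] while [ftilde] and the Sobolev product do
   not, so relating [fhat * norm1] to [ftilde] costs a factor [b1]. *)
Definition ip1 g h : R := b1 * int_ball (fun x => g x * h x * bubble x).

Definition norm1 P Y n k nu : R :=
  ip1 (ball_poly P Y n k nu) (ball_poly P Y n k nu).

Definition fhat P Y f n k nu : R :=
  ip1 f (ball_poly P Y n k nu) / norm1 P Y n k nu.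

End ball_polynomials.

(* Main.v *)
Require Import Defs.
From HB Require Import structures.
From mathcomp Require Import all_boot all_order all_algebra.
From mathcomp Require Import finmap.
From mathcomp Require Import -(notations) mpoly.
From mathcomp Require Import all_classical all_reals all_analysis.
From mathcomp Require Import measurable_realfun ring lra.
Import Order.TTheory GRing.Theory Num.Theory.
Import numFieldNormedType.Exports.
Local Open Scope classical_set_scope.
Local Open Scope ring_scope.

(** The functions v = (1 - |x|^2) R vanish on the sphere and are smooth, so they
    belong to H^1_0 and may be used to test the variational formulation, which
    gives <u, v> = int f v. Conversely R is a polynomial in |x|^2 times a fixed
    harmonic, so the recursion is the image under g |-> int f g (1 - |x|^2) of
    the univariate identity
      P_k = q_k + sum_(k - kap - 1 <= j < k) a_(k,j) q_j.
    The sum is short because (P_k, g)_beta = 0 when deg g + kap + 1 < k: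
    integrating the second term of (P_k, g)_beta by parts turns both terms into
    integrals of P_k against a polynomial of degree < k for the Jacobi weight
    (1 - t) (1 + t)^beta.

    Membership in H^1_0 is obtained with the test functions
    p s exp(-e/s) 1_(s > 0), s = 1 - |x|^2 - e, which converge to p (1 - |x|^2)
    in H^1 as e -> 0, by dominated convergence. When the norm of a basis function
    is 0, the function vanishes almost everywhere on the ball and both sides of
    the identities are 0, so that no such norm has to be shown nonzero. *)

(** * The univariate connection identity *)

Section graded_family.
Context {F : fieldType} (p : nat -> {poly F}).
Hypothesis size_p : forall k, size (p k) = k.+1.

(** Induction on the size: subtracting the multiple of [p n] that cancels the coefficient of degree
    [n] leaves a polynomial within reach of the earlier members. *)
Lemma graded_family_span n (r : {poly F}) : (size r <= n)%N ->
  exists c : nat -> F, r = \sum_(i < n) c i *: p i.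
Proof.
elim: n r => [|n IH] r rn.
  exists (fun=> 0); rewrite big_ord0; apply/eqP.
  by rewrite -size_poly_eq0 -leqn0.
have pn0 : (p n)`_n != 0.
  have := lead_coef_eq0 (p n); rewrite lead_coefE size_p/= => ->.
  by rewrite -size_poly_eq0 size_p.
pose a := r`_n / (p n)`_n.
have [|c rc] := IH (r - a *: p n).
  apply/leq_sizeP => j; rewrite leq_eqVlt => /predU1P[<-|nj].
    by rewrite coefB coefZ /a divfK ?subrr.
  rewrite coefB coefZ (nth_default _ (leq_trans rn nj)).
  by rewrite nth_default ?mulr0 ?subrr// size_p.
exists (fun i => if i == n then a else c i).
rewrite big_ord_recr/= eqxx -[LHS](subrK (a *: p n)) rc; congr (_ + _).
by apply: eq_bigr => i _; rewrite ltn_eqF.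
Qed.

(** Only the last summand reaches degree [n]. Comparing leading coefficients then shows that [q k]
    enters the expansion of [P k] with coefficient 1. *)
Lemma graded_family_lead n (c : nat -> F) :
  (\sum_(i < n.+1) c i *: p i)`_n = c n * lead_coef (p n).
Proof.
rewrite big_ord_recr/= coefD coef_sum big1 ?add0r.
  by rewrite coefZ lead_coefE size_p.
by move=> i _; rewrite coefZ nth_default ?mulr0// size_p.
Qed.

End graded_family.

(** * Integrals of polynomials against (1 + t)^beta *)

Section weighted_integral.
Context {R : realType}.
Implicit Types (beta : R) (p g h r w : {poly R}).

Lemma eq_int_pm1 (f g : R -> R) : (forall t, -1 <= t <= 1 -> f t = g t) ->
  int_pm1 f = int_pm1 g.
Proof. by move=> fg; apply: eq_Rintegral => t; rewrite inE/= in_itv; exact: fg. Qed.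

Lemma is_derive_powR1D beta (x : R) : -1 < x ->
  is_derive x 1 (fun t : R => (1 + t) `^ beta) (beta * (1 + x) `^ (beta - 1)).
Proof.
move=> x1.
have x0 : 0 < 1 + x by rewrite -ltrBlDl sub0r.
have H1 : is_derive (1 + x) 1 (fun y : R => y `^ beta)
  (beta * (1 + x) `^ (beta - 1)) by exact: is_derive1_powR.
have H2 : is_derive x 1 (cst 1 + id : R -> R) 1.
  by apply: is_derive_eq; rewrite add0r.
have := @is_derive1_comp R (fun y : R => y `^ beta) (cst 1 + id) x _ _ H1 H2.
by rewrite mulr1.
Qed.

(** For beta < 1 the power is not differentiable at -1, so the fundamental theorem of calculus is
    fed interior derivability and one-sided limits at the endpoints. *)
Lemma derivable_powR1D beta : 0 < beta ->
  derivable_oo_LRcontinuous (fun t : R => (1 + t) `^ beta) (-1) 1.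
Proof.
move=> b0.
split.
- by move=> x; rewrite in_itv/= => /andP[x1 _]; have [] := is_derive_powR1D beta x x1.
- rewrite subrr powR0 ?gt_eqF//.
  apply: (@cvg_comp _ _ _ (fun t : R => 1 + t) (fun t : R => t `^ beta) _ (0 : R)^'+);
    last exact: powR_cvg0.
  move=> A [e /= e0 He]; exists e => //= y ye y1.
  apply: He; last by rewrite -ltrBlDl sub0r.
  by move: ye; rewrite /ball_/= sub0r normrN -opprD normrN.
- have [] := is_derive_powR1D beta 1; first by lra.
  move=> /derivable1_diffP/differentiable_continuous + _.
  exact: cvg_at_left_filter.
Qed.

Lemma within_continuous_powR1D beta : 0 <= beta ->
  {within `[(-1), 1], continuous (fun t : R => (1 + t) `^ beta)}.
Proof.
rewrite le_eqVlt => /predU1P[<-|b0].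
  (* The convention 0^0 = 1 makes the weight constant up to the endpoint -1. *)
  have -> : (fun t : R => (1 + t) `^ 0) = cst 1 by apply/funext => t; rewrite powRr0.
  by apply: continuous_subspaceT => x; exact: cvg_cst.
exact/derivable_oo_LRcontinuous_within/derivable_powR1D.
Qed.

(** Powers of 1 - t have natural exponents here and are absorbed into the polynomial, so a single
    real exponent remains. *)
Definition jint beta p : R := int_pm1 (fun t => p.[t] * (1 + t) `^ beta).

Lemma within_continuous_jint beta p : 0 <= beta ->
  {within `[(-1), 1], continuous (fun t : R => p.[t] * (1 + t) `^ beta)}.
Proof.
move=> b0 x; apply: (@continuousM _ _ (horner p : subspace `[(-1), 1] -> R)).
  by apply: continuous_subspaceT => {}x; exact: continuous_horner.
exact: within_continuous_powR1D.
Qed.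

Lemma integrable_jint beta p : 0 <= beta ->
  lebesgue_measure.-integrable `[(-1 : R), 1]
    (EFin \o (fun t : R => p.[t] * (1 + t) `^ beta)).
Proof.
move=> b0; apply: continuous_compact_integrable; first exact: segment_compact.
exact: within_continuous_jint.
Qed.

Lemma jint_linear beta a p r : 0 <= beta ->
  jint beta (a *: p + r) = a * jint beta p + jint beta r.
Proof.
move=> b0; rewrite /jint /int_pm1 -RintegralZl ?integrable_jint//.
rewrite -RintegralD ?integrable_jint//; last first.
  rewrite (_ : _ \o _ =
    EFin \o (fun t => (a *: p).[t] * (1 + t) `^ beta)) ?integrable_jint//.
  by apply/funext => t /=; rewrite hornerZ mulrA.
by apply: eq_Rintegral => t _; rewrite hornerD hornerZ mulrDl mulrA.
Qed.

Lemma jint0 beta : 0 <= beta -> jint beta 0 = 0.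
Proof.
by move=> b0; have := jint_linear beta (-1) 0 0 b0; rewrite scaler0 addr0; lra.
Qed.

Lemma jintD beta p r : 0 <= beta -> jint beta (p + r) = jint beta p + jint beta r.
Proof. by move=> b0; rewrite -[p]scale1r jint_linear// mul1r scale1r. Qed.

Lemma jintZ beta a p : 0 <= beta -> jint beta (a *: p) = a * jint beta p.
Proof. by move=> b0; rewrite -[a *: p]addr0 jint_linear// jint0// addr0. Qed.

Lemma jint_sum beta n (p : nat -> {poly R}) : 0 <= beta ->
  jint beta (\sum_(i < n) p i) = \sum_(i < n) jint beta (p i).
Proof.
move=> b0; elim: n => [|n IH]; first by rewrite !big_ord0 jint0.
by rewrite !big_ord_recr/= jintD// IH.
Qed.

Lemma jintS beta p : 0 <= beta -> jint (beta + 1) p = jint beta ((1 + 'X) * p).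
Proof.
move=> b0; apply: eq_int_pm1 => t /andP[t1 _].
have t0 : 0 <= 1 + t by rewrite -lerBlDl sub0r.
rewrite powRD ?powRr1//; last by rewrite gt_eqF// ltr_wpDl.
rewrite hornerM hornerD hornerC hornerX.
by rewrite [RHS]mulrC mulrCA; congr (_ * _); exact: mulrC.
Qed.

(* Fundamental theorem of calculus for t |-> p(t) (1+t)^(beta+1). *)
Lemma jint_deriv beta p : 0 <= beta -> p.[1] = 0 ->
  jint (beta + 1) p^`() = - (beta + 1) * jint beta p.
Proof.
move=> b0 p1.
have b1 : 0 < beta + 1 by lra.
pose F (t : R) := p.[t] * (1 + t) `^ (beta + 1).
pose f (t : R) := p^`().[t] * (1 + t) `^ (beta + 1) +
  ((beta + 1) *: p).[t] * (1 + t) `^ beta.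
have cf : {within `[(-1 : R), 1], continuous f}.
  move=> x; exact: (cvgD (within_continuous_jint (beta + 1) p^`() (ltW b1) x)
    (within_continuous_jint beta ((beta + 1) *: p) b0 x)).
have [dw wl wr] := derivable_powR1D _ b1.
have cp := @continuous_horner R p.
have dF : derivable_oo_LRcontinuous F (-1) 1.
  split.
  - move=> x x1; apply: derivableM; first exact: derivable_horner.
    exact: dw.
  - apply: cvgM => //; apply: cvg_at_right_filter; exact: cp.
  - apply: cvgM => //; apply: cvg_at_left_filter; exact: cp.
have F'f : {in `](-1 : R), 1[, F^`()%classic =1 f}.
  move=> x x1; move: (x1); rewrite in_itv/= => /andP[x1l _].
  have H := is_derive_powR1D (beta + 1) x x1l; rewrite addrK in H.
  rewrite derive1E (_ : F = (horner p * (fun t : R => (1 + t) `^ (beta + 1)))%R)//.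
  rewrite deriveM; [|exact: derivable_horner|exact: dw].
  have [_ ->] := H.
  rewrite -derive1E -derivE /f hornerZ addrC.
  congr (_ + _); first exact: mulrC.
  exact: etrans (mulrCA _ _ _) (mulrA _ _ _).
have := @continuous_FTC2 R f F (-1) 1 _ cf dF F'f.
(* Both boundary terms vanish: at 1 because p(1) = 0, at -1 because the exponent beta + 1 is
   positive. *)
rewrite /F p1 mul0r subrr powR0 ?gt_eqF// mulr0 subee// => /(_ ltac:(lra)) I0.
have : jint (beta + 1) p^`() + jint beta ((beta + 1) *: p) = 0.
  rewrite /jint /int_pm1 -RintegralD ?integrable_jint ?(ltW b1)//.
  by rewrite /Rintegral I0.
by rewrite jintZ// mulNr => /eqP; rewrite addr_eq0 => /eqP.
Qed.

Lemma finite_roots p : p != 0 -> finite_set [set t | p.[t] = 0].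
Proof.
move=> p0; apply: contrapT => /(infinite_set_fset (size p))[B Bp szB].
have := max_poly_roots p0 (_ : all (root p) B) (fset_uniq B).
rewrite ltnNge szB => H; suff: false by []; apply: H.
by apply/allP => x xB; apply/eqP; exact: Bp.
Qed.

(** A nonnegative integrand with zero integral vanishes almost everywhere. If p were nonzero, its
    finitely many roots and the point -1 would then cover [-1, 1] up to a null set, against its
    length 2. *)
Lemma jint_ge0_eq0 beta p : 0 <= beta ->
  (forall t, -1 <= t <= 1 -> 0 <= p.[t]) -> jint beta p = 0 -> p = 0.
Proof.
move=> b0 p0 I0; apply/eqP/negPn/negP => pn0.
pose I := `[(-1 : R), 1]%classic.
have mg := measurable_int _ (integrable_jint beta p b0).
have g0 t : t \in `[(-1 : R), 1]%classic -> 0 <= p.[t] * (1 + t) `^ beta.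
  rewrite inE/= in_itv/= => t1; rewrite mulr_ge0 ?powR_ge0//; exact: p0.
have /(ae_eq_integral_abs lebesgue_measure _ mg) : (\int[lebesgue_measure]_(x in I)
    `|(EFin \o (fun t => (p.[t] * (1 + t) `^ beta)%R)) x|)%E = 0%E.
  rewrite -[RHS]/(0%:E) -I0 /jint /int_pm1 /Rintegral fineK; last first.
    exact/integrable_fin_num/integrable_jint.
  by apply: eq_integral => t t1 /=; rewrite ger0_norm// g0.
move=> /(_ (measurable_itv _)) ae0.
have : lebesgue_measure.-negligible I.
  apply: (@negligibleS _ _ _ lebesgue_measure (~` [set t | I t ->
      (p.[t] * (1 + t) `^ beta)%:E = 0%E] `|`
     ([set t | p.[t] = 0] `|` [set (-1)]))).
    move=> t /= t1.
    have [->|tn1] := eqVneq t (-1); first by right; right.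
    have [pt|pt] := eqVneq p.[t] 0; first by right; left.
    left => /(_ t1) -[] /eqP; rewrite mulf_eq0 (negbTE pt)/= powR_eq0.
    by rewrite addrC addr_eq0 (negbTE tn1).
  apply: negligibleU; first exact: ae0.
  apply: negligibleU.
    apply/negligibleP; last first.
      exact/countable_lebesgue_measure0/finite_set_countable/finite_roots.
    exact/countable_measurable/finite_set_countable/finite_roots.
  by apply/negligibleP => //; exact: lebesgue_measure_set1.
move=> [A [mA A0 IA]]; have : (lebesgue_measure I <= lebesgue_measure A)%E.
  by apply: le_measure; rewrite ?inE//; exact: measurable_itv.
rewrite A0 lebesgue_measure_itv/= lte_fin.
by rewrite ifT ?lee_fin; lra.
Qed.

End weighted_integral.

(** * Orthogonality and the short expansion of Jacobi polynomials *)

Section connection.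
Context {R : realType} (lam : R) (kap : nat) (beta : R) (P q : nat -> {poly R}).
Hypotheses (lam0 : 0 < lam) (beta0 : 0 <= beta).
Hypotheses (jP : jacobi_family 1 beta P) (uq : univ_family lam kap beta P q).

Lemma univ_ipE g h : univ_ip lam kap beta g h =
  lam / 2 ^+ (kap + 3) * jint beta (g * h * (1 - 'X) ^+ (kap + 2)) +
  jint (beta + 1) (((1 - 'X) * g)^`() * ((1 - 'X) * h)^`()).
Proof.
rewrite /univ_ip /jint; congr (_ * int_pm1 _ + int_pm1 _); apply/funext => t.
  by rewrite !hornerM horner_exp !hornerE.
by rewrite [in RHS]hornerM.
Qed.

Lemma univ_ip_sum n (c : nat -> R) (g : nat -> {poly R}) h :
  univ_ip lam kap beta (\sum_(i < n) c i *: g i) h =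
  \sum_(i < n) c i * univ_ip lam kap beta (g i) h.
Proof.
have b1 : 0 <= beta + 1 by rewrite addr_ge0.
rewrite univ_ipE !(mulr_suml, mulr_sumr) linear_sum/= mulr_suml.
rewrite (@jint_sum _ _ _ (fun i => c i *: g i * h * (1 - 'X) ^+ (kap + 2)))//.
rewrite (@jint_sum _ _ _ (fun i => ((1 - 'X) * (c i *: g i))^`() * ((1 - 'X) * h)^`()))//.
rewrite mulr_sumr -big_split/=; apply: eq_bigr => i _.
have -> : c i *: g i * h * (1 - 'X) ^+ (kap + 2) =
    c i *: (g i * h * (1 - 'X) ^+ (kap + 2)) by rewrite -!scalerAl.
have -> : ((1 - 'X) * (c i *: g i))^`() * ((1 - 'X) * h)^`() =
    c i *: (((1 - 'X) * g i)^`() * ((1 - 'X) * h)^`()).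
  by rewrite -scalerAr derivZ -scalerAl.
by rewrite univ_ipE !jintZ// mulrDr mulrCA.
Qed.

(** The factor 1 - X is the Jacobi weight of exponent 1 written as a polynomial; [r] is a
    combination of the [P i] with i < k, each orthogonal to [P k]. *)
Lemma jacobi_orthogonal k (r : {poly R}) : (size r <= k)%N ->
  jint beta ((1 - 'X) * P k * r) = 0.
Proof.
have [szP oP _] := jP => /(graded_family_span _ szP)[c ->].
rewrite mulr_sumr (@jint_sum _ _ _ (fun i => (1 - 'X) * P k * (c i *: P i)))//.
apply: big1 => i _; rewrite -scalerAr jintZ//.
rewrite -[X in _ * X](_ : int_pm1 (fun t => (P i).[t] * (P k).[t] *
          (1 - t) `^ 1 * (1 + t) `^ beta) = _); last first.
  apply: eq_int_pm1 => t /andP[_ t1].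
  by rewrite powRr1 ?subr_ge0// !hornerM !hornerE; ring.
by rewrite oP ?mulr0//; apply/eqP; rewrite ltn_eqF.
Qed.

(** This is what makes the recursion short. The mass term pairs [P k] with g (1 - t)^(kap + 1),
    which dictates the size bound; the derivative term, after integration by parts, pairs it with a
    polynomial of size at most that of [g]. *)
Lemma univ_ip_jacobi k (g : {poly R}) : (size g + kap.+1 <= k)%N ->
  univ_ip lam kap beta (P k) g = 0.
Proof.
move=> gk; set w := ((1 - 'X) * g)^`().
have sX : size (1 - 'X : {poly R}) = 2%N by rewrite -opprB size_polyN size_XsubC.
have sXg : (size (((1 - 'X) * g)%R) <= (size g).+1)%N.
  by apply: leq_trans (size_polyMleq _ _) _; rewrite sX.
have sw : (size w <= size g)%N.
  rewrite /w; have [->|Xg0] := eqVneq ((1 - 'X) * g) 0.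
    by rewrite deriv0 size_poly0.
  by rewrite -ltnS; apply: leq_trans sXg; exact: lt_size_deriv.
have gk' : (size g <= k)%N by apply: leq_trans gk; exact: leq_addr.
rewrite univ_ipE -/w; have -> : jint beta (P k * g * (1 - 'X) ^+ (kap + 2)) = 0.
  (* One of the kap + 2 factors 1 - t serves as the Jacobi weight. *)
  rewrite (_ : _ * _ = (1 - 'X) * P k * (g * (1 - 'X) ^+ kap.+1)); last first.
    by rewrite addn2 exprS; ring.
  apply: jacobi_orthogonal; apply: leq_trans gk.
  apply: leq_trans (size_polyMleq _ _) _.
  have /leq_trans : (size ((1 - 'X : {poly R}) ^+ kap.+1) <= kap.+2)%N.
    by apply: leq_trans (size_poly_exp_leq _ _) _; rewrite sX/= mul1n.
  move=> /(_ _ (leqnn _)) H; rewrite -subn1 leq_subLR add1n -addnS.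
  by rewrite leq_add2l.
rewrite mulr0 add0r.
(* The product (1 - t) P_k w vanishes at 1, so the derivative can be moved onto w; what remains
   tests P_k against (1 + t) w' + (beta + 1) w. *)
have := @jint_deriv _ beta ((1 - 'X) * P k * w) beta0.
rewrite derivM jintD ?addr_ge0//.
rewrite (jintS beta ((1 - 'X) * P k * w^`()))// => E; apply/eqP.
have {E} -> : jint (beta + 1) (((1 - 'X) * P k)^`() * w) =
    - jint beta ((1 - 'X) * P k * ((1 + 'X) * w^`() + (beta + 1) *: w)).
  rewrite mulrDr jintD// -scalerAr jintZ//.
  rewrite [X in jint _ X + _](_ : _ = (1 + 'X) * ((1 - 'X) * P k * w^`())); last by ring.
  rewrite opprD -[- (_ * _)]mulNr -E; first by rewrite [RHS]addrC addrK.
  by rewrite !hornerM !hornerE subrr !mul0r.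
rewrite oppr_eq0 jacobi_orthogonal//; apply: leq_trans gk'.
rewrite (leq_trans (size_polyD _ _))// geq_max.
rewrite (leq_trans (size_scale_leq _ _))// andbT.
have [w0|w0] := eqVneq w 0; first by rewrite w0 deriv0 mulr0 size_poly0.
apply: leq_trans (size_polyMleq _ _) _.
rewrite addrC size_XaddC/=; apply: leq_trans sw.
exact: lt_size_deriv.
Qed.

(** Both terms are nonnegative and the mass term alone is definite, because lam > 0 and g^2 (1 -
    t)^(kap + 2) is a nonzero polynomial. *)
Lemma univ_ip_gt0 g : g != 0 -> 0 < univ_ip lam kap beta g g.
Proof.
move=> g0; rewrite lt_neqAle eq_sym; apply/andP; split; last first.
  rewrite univ_ipE addr_ge0//.
    rewrite mulr_ge0 ?divr_ge0 ?(ltW lam0)//; apply: Rintegral_ge0 => t.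
    rewrite /= in_itv/= => /andP[_ t1]; rewrite mulr_ge0 ?powR_ge0//.
    rewrite !hornerM horner_exp !hornerE -expr2 mulr_ge0 ?sqr_ge0//.
    by rewrite exprn_ge0// subr_ge0.
  apply: Rintegral_ge0 => t _; rewrite hornerM mulr_ge0 ?powR_ge0//.
  by rewrite -expr2 sqr_ge0.
have J1 : 0 <= jint beta (g * g * (1 - 'X) ^+ (kap + 2)).
  apply: Rintegral_ge0 => t.
  rewrite /= in_itv/= => /andP[_ t1]; rewrite mulr_ge0 ?powR_ge0//.
  rewrite !hornerM horner_exp !hornerE -expr2 mulr_ge0 ?sqr_ge0//.
  by rewrite exprn_ge0// subr_ge0.
have J2 : 0 <= jint (beta + 1) (((1 - 'X) * g)^`() * ((1 - 'X) * g)^`()).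
  apply: Rintegral_ge0 => t _; rewrite hornerM mulr_ge0 ?powR_ge0//.
  by rewrite -expr2 sqr_ge0.
have L : 0 < lam / 2 ^+ (kap + 3) by rewrite divr_gt0.
rewrite univ_ipE paddr_eq0 ?(mulr_ge0 (ltW L))//.
apply/negP => /andP[+ _]; rewrite mulf_eq0 gt_eqF//= => /eqP.
move=> /(@jint_ge0_eq0 _ beta _ beta0) H.
have : g * g * (1 - 'X) ^+ (kap + 2) == 0.
  apply/eqP/H => t /andP[_ t1].
  rewrite !hornerM horner_exp !hornerE -expr2 mulr_ge0 ?sqr_ge0//.
  by rewrite exprn_ge0// subr_ge0.
rewrite !mulf_eq0 (negbTE g0)/= expf_eq0 addn2/=.
by rewrite -opprB oppr_eq0 polyXsubC_eq0.
Qed.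

(** Expand [P k] in [q 0], ..., [q k]. Equal leading coefficients give [q k] the coefficient 1,
    orthogonality identifies the others, and [univ_ip_jacobi] removes those of low index. Truncated
    subtraction supplies the maximum with 0 in the lower bound. *)
Lemma jacobi_connection k : P k =
  q k + \sum_(k - kap.+1 <= j < k) conn_coef lam kap beta P q k j *: q j.
Proof.
have [szP _ _] := jP; have [szq oq lq] := uq.
have [c Pc] := graded_family_span q szq k.+1 (P k) (eq_leq (szP k)).
have qn0 j : q j != 0 by rewrite -size_poly_eq0 szq.
have ck : c k = 1.
  have := graded_family_lead q szq k c; rewrite -Pc => /eqP.
  rewrite lq lead_coefE szP/= -[X in X == _]mul1r => /eqP/mulIf -> //.
  have : lead_coef (q k) != 0 by rewrite lead_coef_eq0.
  by rewrite lq lead_coefE szP.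
have cj j : (j < k)%N -> conn_coef lam kap beta P q k j = c j.
  move=> jk; rewrite /conn_coef Pc univ_ip_sum.
  have jk1 : (j < k.+1)%N by apply: ltnW.
  rewrite (bigD1 (Ordinal jk1))//= big1 ?addr0.
    by rewrite mulfK// gt_eqF// univ_ip_gt0.
  move=> i ij; rewrite oq ?mulr0// => ijE; case/eqP: ij; exact: val_inj.
rewrite {1}Pc big_ord_recr/= ck scale1r addrC; congr (_ + _).
rewrite -(big_mkord xpredT (fun i => c i *: q i)).
rewrite (@big_cat_nat _ _ _ (k - kap.+1))//= ?leq_subr// [X in X + _]big1_seq ?add0r.
  by apply: eq_big_nat => i /andP[_ /cj ->].
move=> i /=; rewrite mem_index_iota => /andP[_ ik].
rewrite -cj; last by apply: leq_trans ik _; exact: leq_subr.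
rewrite /conn_coef univ_ip_jacobi ?mul0r ?scale0r// szq.
(* As [q i] has size i + 1, the vanishing condition i + 1 + (kap + 1) <= k is exactly i < k - (kap +
   1). *)
by rewrite addnC addnS -ltn_subRL.
Qed.

End connection.

(** * Lebesgue measure on R^n *)

Section borel_rV.
Context {R : realType} (n : nat).
Implicit Types (U D : set 'rV[R]_n).

(** Open boxes with rational centre and radius 1 / (k + 1): a countable base of the topology, made
    of sets in the sigma-algebra of the coordinates. *)
Definition rat_box (c : 'rV[rat]_n) (k : nat) : set 'rV[R]_n :=
  \bigcap_(i in [set: 'I_n]) (fun x : 'rV[R]_n => x 0 i) @^-1`
    `]ratr (c 0 i) - k.+1%:R^-1, ratr (c 0 i) + k.+1%:R^-1[.

Lemma measurable_rat_box c k : measurable (rat_box c k).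
Proof.
apply: fin_bigcap_measurable => // i _.
by rewrite -[X in measurable X]setTI; exact: measurable_coord.
Qed.

Lemma open_measurable_rV U : open U -> measurable U.
Proof.
move=> oU.
pose F (ck : 'rV[rat]_n * nat) : set 'rV[R]_n :=
  if pselect (rat_box ck.1 ck.2 `<=` U) then rat_box ck.1 ck.2 else set0.
have -> : U = \bigcup_ck F ck.
  apply/seteqP; split=> [x Ux|x [ck _]]; last first.
    by rewrite /F; case: pselect => // sub /sub.
  have /nbhs_ballP[e /= e0 xeU] := open_nbhs_nbhs (conj oU Ux).
  (* The radius r = 1 / (k + 1) is below e / 2: a box whose centre is within r of x contains x and
     stays within 2 r < e of it. *)
  pose k := Num.truncn (2 / e).
  have ke : 2 / e < k.+1%:R by exact: truncnS_gt.
  have [r [rE r0 re]] : exists r : R, [/\ r = k.+1%:R^-1, 0 < r & r < e / 2].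
    exists k.+1%:R^-1; split=> //.
    by rewrite -[e / 2]invf_div ltf_pV2 ?posrE ?divr_gt0.
  have /choice[c cx] (i : 'I_n) : exists s : rat, x 0 i - r < ratr s < x 0 i + r.
    have [|s] := @rat_in_itvoo R (x 0 i - r) (x 0 i + r); first by lra.
    by rewrite in_itv/=; exists s.
  exists (\row_i c i, k) => //; rewrite /F; case: pselect => /= [_|].
    move=> i _; rewrite /= in_itv/= mxE -rE; have /andP[] := cx i.
    by move=> ? ?; apply/andP; split; lra.
  case=> y yb; apply: xeU; split=> // i j; rewrite (ord1 i).
  have := yb j I; rewrite /= in_itv/= mxE -rE => /andP[y1 y2].
  have /andP[c1 c2] := cx j.
  by rewrite /ball/= ltr_norml; apply/andP; split; lra.
apply: countable_bigcupT_measurable; first exact: countableP.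
move=> ck; rewrite /F; case: pselect => //= _; exact: measurable_rat_box.
Qed.

Lemma within_continuous_measurable_rV D (f : 'rV[R]_n -> R) :
  measurable D -> {within D, continuous f} -> measurable_fun D f.
Proof.
move=> mD /continuousP cf; apply: (measurability _ (RGenOpens.measurableE R)).
move=> _ [_ [a [b ->] <-]].
have /open_subspaceP[V oV VD] := cf _ (@interval_open R (BRight a) (BLeft b) isT isT).
by rewrite setIC -VD; apply: measurableI => //; exact: open_measurable_rV.
Qed.

Lemma continuous_measurable_rV (f : 'rV[R]_n -> R) :
  continuous f -> measurable_fun setT f.
Proof.
move=> cf; apply: within_continuous_measurable_rV => //.
exact: continuous_subspaceT.
Qed.

End borel_rV.

(** * Cubes, slices and the integral of a partial derivative *)

Section lebesgue_rV_theory.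
Context {R : realType}.

Definition cube n (M : R) : set 'rV[R]_n := [set x | forall i, `|x 0 i| <= M].

Lemma measurable_cube n M : measurable (cube n M).
Proof.
rewrite (_ : cube n M = \bigcap_(i in [set: 'I_n])
    (fun x : 'rV[R]_n => x 0 i) @^-1` `[- M, M]).
  apply: fin_bigcap_measurable => // i _.
  by rewrite -[X in measurable X]setTI; exact: measurable_coord.
apply/seteqP; split=> x /= xM i; first by move=> _; rewrite /= in_itv/= -ler_norml.
by have := xM i I; rewrite /= in_itv/= -ler_norml.
Qed.

Lemma compact_cube n M : compact (cube n M).
Proof.
rewrite (_ : cube n M = [set x | forall i, `[- M, M]%classic (x ord0 i)]).
  by apply: (@rV_compact _ n (fun=> `[- M, M]%classic)) => i; exact: segment_compact.
by apply/seteqP; split=> x /= xM i; have := xM i; rewrite /= in_itv/= ler_norml.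
Qed.

Lemma lebesgue_rVS n (A : set 'rV[R]_n.+1) : lebesgue_rV n.+1 A =
  (lebesgue_measure \x lebesgue_rV n)%E (@rV_cons R n @^-1` A).
Proof. by []. Qed.

(** Under [rV_cons] a cube is the product of an interval and a cube of one dimension less. *)
Lemma lebesgue_cube_fin n M : (lebesgue_rV n (cube n M) < +oo)%E.
Proof.
elim: n => [|n IH].
  by rewrite /= diracE; case: (_ \in _); rewrite ltry.
rewrite lebesgue_rVS (_ : _ @^-1` _ = `[- M, M] `*` cube n M); last first.
  apply/seteqP; split=> [[t x]|[t x]] /= .
    move=> H; split.
      by rewrite in_itv/= -ler_norml; have := H ord0; rewrite rV_consE0.
    by move=> i; have := H (lift ord0 i); rewrite rV_consES.
  rewrite in_itv/= -ler_norml => -[tM xM] i.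
  by case: (unliftP ord0 i) => [j|] ->; rewrite ?rV_consES ?rV_consE0.
rewrite product_measure1E//; last exact: measurable_cube.
apply: lte_mul_pinfty => //; last first.
rewrite -[X in X \is a fin_num]/(lebesgue_measure `[- M, M]%classic).
by rewrite lebesgue_measure_itv/=; case: ifPn.
Qed.

Lemma integrable_cube n (h : 'rV[R]_n -> R) M : continuous h ->
  (forall x, ~ cube n M x -> h x = 0) ->
  (lebesgue_rV n).-integrable setT (EFin \o h).
Proof.
move=> ch h0.
have : (lebesgue_rV n).-integrable (cube n M) (EFin \o h).
  apply: measurable_bounded_integrable.
  - exact: measurable_cube.
  - exact: lebesgue_cube_fin.
  - by apply: measurable_funTS; exact: continuous_measurable_rV.
  - have /compact_bounded[N [_ Nh]] :=
      continuous_compact (continuous_subspaceT ch) (compact_cube n M).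
    exists N; split; rewrite ?num_real // => ? ? ? ?; exact: Nh.
move/(integrable_mkcond _ (measurable_cube n M)).
rewrite (_ : _ \_ _ = EFin \o h)//; apply/funext => x.
rewrite patchE; case: ifPn => // /negP; rewrite inE => /h0 /= ->//.
Qed.

(** The two difference quotients coincide, as [phi] carries one line affinely onto the other. Hence
    an equivalence, with no differentiability of [phi] or [g] assumed; it transfers partial
    derivatives to slices and lines. *)
Lemma is_derive_comp_line (V W : normedModType R) (g : V -> R) (phi : W -> V)
    (w : W) (v : V) (a : W) (l : R) :
  (forall h : R, phi (h *: w + a) = h *: v + phi a) ->
  is_derive a w (g \o phi) l <-> is_derive (phi a) v g l.
Proof.
move=> phiE.
have E : (fun h : R => h^-1 *: (((g \o phi) \o shift a) (h *: w) - (g \o phi) a)) =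
    (fun h => h^-1 *: ((g \o shift (phi a)) (h *: v) - g (phi a))).
  by apply/funext => h /=; rewrite phiE.
have Ed : derivable (g \o phi) a w = derivable g (phi a) v by rewrite /derivable E.
have ED : 'D_w (g \o phi) a = 'D_v g (phi a) by rewrite /derive E.
by split=> -[]; rewrite ?Ed ?ED => dg gl; split; rewrite ?Ed ?ED.
Qed.

Lemma rV_cons_axis0 n (t h : R) (x : 'rV[R]_n) :
  rV_cons (h *: 1 + t : R, x) = h *: axis ord0 + rV_cons (t, x).
Proof.
apply/rowP => i; rewrite [RHS]mxE [X in _ = X + _]mxE [X in _ = _ * X + _]mxE eqxx/=.
case: (unliftP ord0 i) => [j|] ->; rewrite ?rV_consES ?rV_consE0 ?eqxx//=.
by rewrite mulr0 add0r.
Qed.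

Lemma rV_cons_axisS n (t h : R) (x : 'rV[R]_n) i :
  rV_cons (t, h *: axis i + x) = h *: axis (lift ord0 i) + rV_cons (t, x).
Proof.
apply/rowP => j; rewrite [RHS]mxE [X in _ = X + _]mxE [X in _ = _ * X + _]mxE eqxx/=.
case: (unliftP ord0 j) => [k|] ->; rewrite ?rV_consES ?rV_consE0 ?eqxx//=.
  by rewrite !mxE eqxx/= (inj_eq lift_inj).
by rewrite mulr0 add0r.
Qed.

Lemma continuous_rV_cons_r n (t : R) :
  continuous (fun x : 'rV[R]_n => rV_cons (t, x) : 'rV[R]_n.+1).
Proof.
move=> x A /nbhs_ballP[e /= e0 eA]; apply/nbhs_ballP; exists e => //= y [_ xy].
apply: eA; split=> // i j; rewrite (ord1 i).
case: (unliftP ord0 j) => [k|] ->; first by rewrite !rV_consES; exact: xy.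
by rewrite !rV_consE0; exact: ballxx.
Qed.

Lemma continuous_rV_cons_l n (x : 'rV[R]_n) :
  continuous (fun t : R => rV_cons (t, x) : 'rV[R]_n.+1).
Proof.
move=> t A /nbhs_ballP[e /= e0 eA]; apply/nbhs_ballP; exists e => //= s ts.
apply: eA; split=> // i j; rewrite (ord1 i).
case: (unliftP ord0 j) => [k|] ->; last by rewrite !rV_consE0.
by rewrite !rV_consES; exact: ballxx.
Qed.

(** The integral reduces to [-1, 1], where it equals g(1) - g(-1) = 0. *)
Lemma int_derive_eq0 (g h : R -> R) : (forall t : R, is_derive t (1 : R) g (h t)) ->
  continuous h -> (forall t, 1 <= `|t| -> g t = 0) ->
  (forall t, 1 < `|t| -> h t = 0) ->
  (\int[lebesgue_measure]_t (h t)%:E = 0)%E.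
Proof.
move=> dg ch g0 h0.
have cg : continuous g.
  by move=> t; apply/differentiable_continuous/derivable1_diffP; have [] := dg t.
rewrite (_ : \int[_]_t _ = \int[lebesgue_measure]_(t in `[(- 1%R)%R, 1%R]) (h t)%:E)%E.
  rewrite (@continuous_FTC2 R h g).
  - by rewrite !g0 ?normrN ?normr1// subee.
  - by lra.
  - exact: continuous_subspaceT.
  - split; first by move=> t _; have [] := dg t.
    + exact/cvg_at_right_filter/cg.
    + exact/cvg_at_left_filter/cg.
  - by move=> t _; rewrite derive1E; have [_ ->] := dg t.
rewrite [RHS]integral_mkcond; apply: eq_integral => t _.
rewrite patchE; case: ifPn => //; rewrite notin_setE/= in_itv/= -ler_norml.
by move=> /negP; rewrite -ltNge => /h0 ->.
Qed.

(** Fubini and induction on the dimension. The support conditions bear on every coordinate so that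
    they pass to slices. *)
Lemma int_partial_eq0 n (i : 'I_n) (g h : 'rV[R]_n -> R) :
  (forall x, is_derive x (axis i) g (h x)) -> continuous h ->
  (forall (x : 'rV[R]_n) j, 1 <= `|x 0 j| -> g x = 0) ->
  (forall (x : 'rV[R]_n) j, 1 < `|x 0 j| -> h x = 0) ->
  (\int[lebesgue_rV n]_x (h x)%:E = 0)%E.
Proof.
elim: n i g h => [[]//|n IH] i g h dg ch g0 h0.
have mh : measurable_fun setT (EFin \o h).
  apply/measurable_EFinP; exact: continuous_measurable_rV.
have ih : (lebesgue_rV n.+1).-integrable setT (EFin \o h).
  apply: (@integrable_cube _ _ 1) => // x /existsNP[j /negP].
  by rewrite -ltNge; exact: h0.
have ihc : (lebesgue_measure \x lebesgue_rV n)%E.-integrable setT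
    ((EFin \o h) \o @rV_cons R n).
  apply/integrableP; split; first exact: measurableT_comp.
  move/integrableP : ih => [_]; apply: le_lt_trans.
  rewrite -[X in (X <= _)%E](_ : (\int[pushforward (lebesgue_measure \x lebesgue_rV n)%E
      (@rV_cons R n)]_x `|(EFin \o h) x|)%E = _)//.
  by rewrite ge0_integral_pushforward//; exact: measurableT_comp.
transitivity (\int[lebesgue_measure \x lebesgue_rV n]_z
    ((EFin \o h) \o @rV_cons R n) z)%E.
  rewrite -[LHS]/(\int[pushforward (lebesgue_measure \x lebesgue_rV n)%E
      (@rV_cons R n)]_x (EFin \o h) x)%E.
  by rewrite integral_pushforward.
case: (unliftP ord0 i) => [j|] ij.
  (* The direction is not the first one: with the first coordinate frozen, the inner integral
     vanishes by induction. *)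
  rewrite -integral12_prod_meas1//; apply: integral0_eq => t _ /=.
  apply: (IH j (fun x => g (rV_cons (t, x)))).
  - move=> x; apply/(@is_derive_comp_line _ _ g (fun x => rV_cons (t, x)) _ (axis i)) => //.
    by move=> s; rewrite ij rV_cons_axisS.
  - move=> x; apply: continuous_comp; [exact: continuous_rV_cons_r|exact: ch].
  - by move=> x k x1; apply: (g0 _ (lift ord0 k)); rewrite rV_consES.
  - by move=> x k x1; apply: (h0 _ (lift ord0 k)); rewrite rV_consES.
(* The direction is the first one: integrate along it first. *)
rewrite -integral21_prod_meas1//; apply: integral0_eq => x _ /=.
apply: (int_derive_eq0 (fun t => g (rV_cons (t, x)))).
- move=> t; apply/(@is_derive_comp_line _ _ g (fun t => rV_cons (t, x)) _ (axis i)) => //.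
  by move=> s; rewrite ij rV_cons_axis0.
- move=> t; apply: continuous_comp; [exact: continuous_rV_cons_l|exact: ch].
- by move=> t t1; apply: (g0 _ ord0); rewrite rV_consE0.
- by move=> t t1; apply: (h0 _ ord0); rewrite rV_consE0.
Qed.

End lebesgue_rV_theory.

(** * Flat exponentials and polynomial functions *)

Section flat_exponential.
Context {R : realType} (e : R).
Hypothesis e0 : 0 < e.

(** The negative power is carried along so that derivatives are combinations of members of the same
    family; [a = 0] is the classical flat function. *)
Definition flat_exp (a : nat) (s : R) : R :=
  if 0 < s then s^-1 ^+ a * expR (- (e / s)) else 0.

Lemma flat_exp_gt0 a s : 0 < s -> flat_exp a s = s^-1 ^+ a * expR (- (e / s)).
Proof. by rewrite /flat_exp => ->. Qed.

Lemma flat_exp_le0 a s : s <= 0 -> flat_exp a s = 0.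
Proof. by rewrite /flat_exp ltNge => ->. Qed.

Lemma flat_exp_ge0 a s : 0 <= flat_exp a s.
Proof.
have [s0|s0] := ltP 0 s; last by rewrite flat_exp_le0.
by rewrite flat_exp_gt0// mulr_ge0 ?expR_ge0// exprn_ge0// invr_ge0 ltW.
Qed.

Lemma flat_expS a s : s * flat_exp a.+1 s = flat_exp a s.
Proof.
have [s0|s0] := ltP 0 s; last by rewrite !flat_exp_le0// mulr0.
by rewrite !flat_exp_gt0// exprS !mulrA divff ?mul1r// gt_eqF.
Qed.

(** One term of the exponential series gives (e/s)^(a+2) / (a+2)! <= exp(e/s); inverting leaves two
    spare powers of s, enough for a zero derivative at 0. *)
Lemma flat_exp_bound a s : flat_exp a s <= (a.+2)`!%:R / e ^+ a.+2 * s ^+ 2.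
Proof.
have [s0|s0] := ltP 0 s; last first.
  by rewrite flat_exp_le0// mulr_ge0 ?sqr_ge0// divr_ge0// exprn_ge0// ltW.
rewrite flat_exp_gt0// expRN.
have es : 0 < e / s by rewrite divr_gt0.
have f0 : (0 : R) < (a.+2)`!%:R by rewrite ltr0n fact_gt0.
have H : (e / s) ^+ a.+2 / (a.+2)`!%:R <= expR (e / s).
  by apply: le_trans (expR_ge1Dxn a.+1 (ltW es)); rewrite lerDr.
apply: (@le_trans _ _ (s^-1 ^+ a * ((e / s) ^+ a.+2 / (a.+2)`!%:R)^-1)).
  rewrite ler_pM2l ?exprn_gt0 ?invr_gt0// lef_pV2// ?posrE ?expR_gt0//.
  by rewrite divr_gt0// exprn_gt0.
rewrite le_eqVlt; apply/orP; left; apply/eqP.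
rewrite exprVn expr_div_n (_ : s ^+ a.+2 = s ^+ a * s ^+ 2); last first.
  by rewrite -exprD addn2.
have := lt0r_neq0 (exprn_gt0 a s0); have := lt0r_neq0 (exprn_gt0 a.+2 e0).
move: (s ^+ a) (e ^+ a.+2) (lt0r_neq0 s0) (lt0r_neq0 f0) => u v sn fn vn un.
by field; rewrite un vn sn fn.
Qed.

Lemma is_derive0_quadratic (f : R -> R) (C : R) :
  (forall s, `|f s| <= C * s ^+ 2) -> is_derive (0 : R) (1 : R) f 0.
Proof.
move=> fC; have f0 : f 0 = 0.
  by apply/eqP; rewrite -normr_le0 (le_trans (fC 0))// expr0n/= mulr0.
have C0 : 0 <= C by have := le_trans (normr_ge0 _) (fC 1); rewrite expr1n mulr1.
have cv : (fun h : R => h^-1 *: ((f \o shift 0) (h *: (1 : R)) - f 0)) @ 0^' --> (0 : R).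
  apply/cvgrPdist_lt => eps eps0; near=> h.
  have h0 : h != 0 by near: h; exact: nbhs_dnbhs_neq.
  rewrite sub0r normrN f0 subr0/= addr0 normrM normfV.
  rewrite ltr_pdivrMl ?normr_gt0//.
  have -> : h *: (1 : R) = h by exact: mulr1.
  apply: le_lt_trans (fC h) _.
  rewrite -[h ^+ 2]ger0_norm ?sqr_ge0// normrX expr2 mulrA.
  rewrite mulrC ltr_pM2l ?normr_gt0//.
  (* [C] may be 0, hence the denominator C + 1. *)
  have : `|h| < eps / (C + 1).
    near: h; apply: dnbhs0_lt; rewrite divr_gt0//; lra.
  rewrite ltr_pdivlMr; last lra.
  apply: le_lt_trans; rewrite mulrC ler_wpM2l//; lra.
split; first by apply/cvg_ex; exists 0.
exact: cvg_lim cv.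
Unshelve. all: by end_near. Qed.

Lemma is_derive_flat_exp a (s : R) : is_derive s (1 : R) (flat_exp a)
  (- a%:R * flat_exp a.+1 s + e * flat_exp a.+2 s).
Proof.
have [s0|s0|<-] := ltgtP 0 s.
- have near_s : \forall t \near s, 0 < t by exact: lt_nbhsr.
  apply: (@near_eq_is_derive R R R (fun t : R => t^-1 ^+ a * expR (- (e * t^-1)))).
    by near=> t; rewrite flat_exp_gt0//; near: t.
  have dV : is_derive s (1 : R) (fun t : R => t^-1) (- s ^- 2).
    have := is_deriveV (lt0r_neq0 s0) (is_derive_id s (1 : R)).
    by rewrite /GRing.scale/= mulr1.
  have dX := is_deriveX a dV.
  have dL : is_derive s (1 : R) (fun t : R => - (e * t^-1)) (e * s ^- 2).
    have := is_deriveN (is_deriveM (is_derive_cst e s (1 : R)) dV).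
    by rewrite /GRing.scale/= mulr0 addr0 mulrN opprK.
  have dE := is_derive1_comp (is_derive_expR _) dL.
  have dM := is_deriveM dX dE.
  have -> : (fun t : R => t^-1 ^+ a * expR (- (e * t^-1))) =
      (fun t : R => t^-1) ^+ a * (expR \o (fun t : R => - (e * t^-1))).
    by apply/funext => t; rewrite !fctE.
  apply: (is_derive_eq dM).
  rewrite !flat_exp_gt0// [X in X *: _](_ : _ = s^-1 ^+ a); last by rewrite !fctE.
  rewrite /GRing.scale/=.
  rewrite -!exprVn; move: (expR (- (e / s))) => E.
  set r := s^-1.
  case: (a) => [|b].
    by rewrite !expr0 !mul0r !mulr0 addr0 oppr0 mul0r add0r expr2; ring.
  by rewrite /= !exprS; ring.
- have near_s : \forall t \near s, t < 0 by exact: lt_nbhsl.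
  rewrite !flat_exp_le0 ?ltW// !mulr0 addr0.
  apply: (@near_eq_is_derive R R R (cst 0)) => //.
  by near=> t; rewrite flat_exp_le0//; apply/ltW; near: t.
- rewrite !flat_exp_le0// !mulr0 addr0.
  apply: (is_derive0_quadratic _ ((a.+2)`!%:R / e ^+ a.+2)) => t.
  by rewrite ger0_norm ?flat_exp_ge0// flat_exp_bound.
Unshelve. all: by end_near. Qed.

Lemma continuous_flat_exp a : continuous (flat_exp a).
Proof.
move=> s; apply/differentiable_continuous/derivable1_diffP.
by have [] := is_derive_flat_exp a s.
Qed.

End flat_exponential.

(** * Polynomial functions and their partial derivatives *)

Section polynomial_functions.
Context {R : realType} {d : nat}.
Implicit Types (f g p : 'rV[R]_d -> R) (x : 'rV[R]_d) (i j : 'I_d).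

(** A predicate on functions rather than a type of polynomials: continuity and closure under partial
    derivatives follow by induction, and |x|^2, univariate composites and harmonics are all
    covered. *)
Inductive polyfun : ('rV[R]_d -> R) -> Prop :=
| polyfun_cst c : polyfun (fun=> c)
| polyfun_coord i : polyfun (fun x => x 0 i)
| polyfunD f g : polyfun f -> polyfun g -> polyfun (fun x => f x + g x)
| polyfunM f g : polyfun f -> polyfun g -> polyfun (fun x => f x * g x).

Lemma polyfunB f g : polyfun f -> polyfun g -> polyfun (fun x => f x - g x).
Proof.
move=> pf pg; rewrite (_ : (fun _ => _) = (fun x => f x + -1 * g x)).
  exact/polyfunD/polyfunM/pg/polyfun_cst.
by apply/funext => x; rewrite mulN1r.
Qed.

Lemma polyfunX f n : polyfun f -> polyfun (fun x => f x ^+ n).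
Proof.
move=> pf; elim: n => [|n IH]; first exact: polyfun_cst.
by under eq_fun do rewrite exprS; exact: polyfunM.
Qed.

Lemma polyfun_sum (I : Type) (r : seq I) (F : I -> 'rV[R]_d -> R) :
  (forall k, polyfun (F k)) -> polyfun (fun x => \sum_(i <- r) F i x).
Proof.
move=> pF; elim: r => [|i r IH].
  by under eq_fun do rewrite big_nil; exact: polyfun_cst.
by under eq_fun do rewrite big_cons; exact: polyfunD.
Qed.

Lemma polyfun_prod (I : Type) (r : seq I) (F : I -> 'rV[R]_d -> R) :
  (forall k, polyfun (F k)) -> polyfun (fun x => \prod_(i <- r) F i x).
Proof.
move=> pF; elim: r => [|i r IH].
  by under eq_fun do rewrite big_nil; exact: polyfun_cst.
by under eq_fun do rewrite big_cons; exact: polyfunM.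
Qed.

Lemma polyfun_horner (p : {poly R}) f : polyfun f -> polyfun (fun x => p.[f x]).
Proof.
move=> pf; under eq_fun do rewrite horner_coef.
by apply: polyfun_sum => i; apply: polyfunM; [exact: polyfun_cst|exact: polyfunX].
Qed.

Lemma polyfun_mpoly_at (p : mpoly d R) : polyfun (mpoly_at p).
Proof.
rewrite (_ : mpoly_at p = (fun x => \sum_(m <- msupp p)
    mcoeff m p * \prod_(i < d) x 0 i ^+ m i)) //.
apply: polyfun_sum => m; apply: polyfunM; first exact: polyfun_cst.
by apply: polyfun_prod => i; apply: polyfunX; exact: polyfun_coord.
Qed.

Lemma dot_ge0 x : 0 <= dot x x.
Proof. by apply: sumr_ge0 => i _; rewrite -expr2 sqr_ge0. Qed.

Lemma enorm_sqr x : enorm x ^+ 2 = dot x x.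
Proof. by rewrite sqr_sqrtr// dot_ge0. Qed.

Lemma bubbleE x : bubble x = 1 - dot x x.
Proof. by rewrite /bubble enorm_sqr. Qed.

Lemma polyfun_dot : polyfun (fun x => dot x x).
Proof. by apply: polyfun_sum => i; apply: polyfunM; exact: polyfun_coord. Qed.

Lemma polyfun_bubble : polyfun (@bubble R d).
Proof.
rewrite (_ : @bubble R d = fun x => 1 - dot x x).
  by apply: polyfunB; [exact: polyfun_cst|exact: polyfun_dot].
by apply/funext => x; rewrite bubbleE.
Qed.

Lemma polyfun_ball_poly (p : R -> nat -> {poly R}) Y (n j nu : nat) :
  polyfun (ball_poly p Y n j nu).
Proof.
apply: polyfunM; last exact: polyfun_mpoly_at.
rewrite (_ : (fun _ => _) = fun x =>
    (p (@beta_of R d n j) j).[2 * dot x x - 1]).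
  apply: polyfun_horner; apply: polyfunB; last exact: polyfun_cst.
  by apply: polyfunM; [exact: polyfun_cst|exact: polyfun_dot].
by apply/funext => x; rewrite enorm_sqr.
Qed.

Lemma continuous_polyfun f : polyfun f -> continuous f.
Proof.
elim=> [c|i|g h _ cg _ ch|g h _ cg _ ch] x.
- exact: cst_continuous.
- exact: coord_continuous.
- exact: (cvgD (cg x) (ch x)).
- exact: (cvgM (cg x) (ch x)).
Qed.

Lemma is_derive_coord x i j :
  is_derive x (axis i) (fun y : 'rV[R]_d => y 0 j) (j == i)%:R.
Proof.
apply/(@is_derive_comp_line _ _ _ id (fun y : 'rV[R]_d => y 0 j)
  (axis i) ((j == i)%:R : R)).
  by move=> h; rewrite !mxE eqxx.
Qed.

Lemma polyfun_derive f : polyfun f -> exists df : 'I_d -> 'rV[R]_d -> R,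
  (forall i, polyfun (df i)) /\ forall i x, is_derive x (axis i) f (df i x).
Proof.
elim=> [c|j|g h pg [dg [pdg gd]] ph [dh [pdh hd]]|
        g h pg [dg [pdg gd]] ph [dh [pdh hd]]].
- exists (fun _ _ => 0); split; first by move=> i; exact: polyfun_cst.
  by move=> i x; exact: is_derive_cst.
- exists (fun i _ => (j == i)%:R); split; first by move=> i; exact: polyfun_cst.
  by move=> i x; exact: is_derive_coord.
- exists (fun i x => dg i x + dh i x); split; first by move=> i; exact: polyfunD.
  by move=> i x; apply: is_deriveD.
- exists (fun i x => g x * dh i x + h x * dg i x); split.
    by move=> i; apply: polyfunD; exact: polyfunM.
  by move=> i x; apply: is_deriveM.
Qed.

(** Restriction to the line through x along the axis reduces this to the chain rule in one
    variable. *)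
Lemma is_derive_comp_axis (phi : R -> R) f x i (l l' : R) :
  is_derive (f x) (1 : R) phi l -> is_derive x (axis i) f l' ->
  is_derive x (axis i) (fun y => phi (f y)) (l * l').
Proof.
move=> dphi df; pose L (h : R) : 'rV[R]_d := h *: axis i + x.
have L0 : L 0 = x by rewrite /L scale0r add0r.
have LE (h : R) : L (h *: (1 : R) + 0) = h *: axis i + L 0.
  by rewrite L0 /L addr0 [h *: 1]mulr1.
rewrite -L0; apply/(is_derive_comp_line _ _ (fun y => phi (f y)) L 1 (axis i) 0 _ LE).
have dfL : is_derive (0 : R) (1 : R) (f \o L) l'.
  by apply/(is_derive_comp_line _ _ f L 1 (axis i) 0 _ LE); rewrite L0.
apply: (@is_derive1_comp R phi (f \o L) 0 l l' _ dfL).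
by rewrite /= L0.
Qed.

End polynomial_functions.

(** * Integration and test functions on the ball *)

Section ball_integrals.
Context {R : realType} {d : nat}.
Implicit Types (f g h : 'rV[R]_d -> R) (x : 'rV[R]_d).

Lemma BallE x : Ball x <-> 0 <= bubble x.
Proof. by rewrite /Ball/= /bubble subr_ge0 expr_le1// sqrtr_ge0. Qed.

Lemma openBallE x : openBall x <-> 0 < bubble x.
Proof. by rewrite /openBall/= /bubble subr_gt0 expr_lt1// sqrtr_ge0. Qed.

Lemma sqr_coord_le_dot x i : x 0 i ^+ 2 <= dot x x.
Proof.
rewrite /dot (bigD1 i)//= -expr2 lerDl.
by apply: sumr_ge0 => j _; rewrite -expr2 sqr_ge0.
Qed.

Lemma openBall_coord x i : openBall x -> `|x 0 i| < 1.
Proof.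
move=> /openBallE; rewrite bubbleE subr_gt0 => x1.
rewrite -(@expr_lt1 _ 2)// -normrX ger0_norm ?sqr_ge0//.
exact: le_lt_trans (sqr_coord_le_dot x i) x1.
Qed.

Lemma Ball_sub_cube : Ball `<=` cube d (1 : R).
Proof.
move=> x /BallE; rewrite bubbleE subr_ge0 => x1 i.
rewrite -(@expr_le1 _ 2)// -normrX ger0_norm ?sqr_ge0//.
exact: le_trans (sqr_coord_le_dot x i) x1.
Qed.

Lemma compact_Ball : compact (@Ball R d).
Proof.
apply: subclosed_compact (compact_cube d 1) Ball_sub_cube.
rewrite (_ : Ball = @bubble R d @^-1` [set y | 0 <= y]).
  apply: preimage_closed => [x _|]; last exact: closed_ge.
  exact/continuous_polyfun/polyfun_bubble.
by apply/seteqP; split=> x /=; [move/BallE|move=> ?; apply/BallE].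
Qed.

Lemma lebesgue_Ball_fin : (lebesgue_rV d (@Ball R d) < +oo)%E.
Proof.
apply: le_lt_trans (lebesgue_cube_fin d 1).
apply: le_measure; rewrite ?inE; [exact: measurable_Ball|exact: measurable_cube|].
exact: Ball_sub_cube.
Qed.

Lemma integrable_Ball f : {within Ball, continuous f} ->
  (lebesgue_rV d).-integrable Ball (EFin \o f).
Proof.
move=> cf; apply: measurable_bounded_integrable.
- exact: measurable_Ball.
- exact: lebesgue_Ball_fin.
- by apply: within_continuous_measurable_rV => //; exact: measurable_Ball.
- have /compact_bounded[N [_ Nf]] := continuous_compact cf compact_Ball.
  by exists N; split; rewrite ?num_real // => ? ? ? ?; exact: Nf.
Qed.

Lemma integrable_Ball_continuous f : continuous f ->
  (lebesgue_rV d).-integrable Ball (EFin \o f).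
Proof. by move=> cf; apply: integrable_Ball; exact: continuous_subspaceT. Qed.

Lemma le_integrable_Ball f g : measurable_fun Ball f ->
  (forall x, Ball x -> `|f x| <= g x) ->
  (lebesgue_rV d).-integrable Ball (EFin \o g) ->
  (lebesgue_rV d).-integrable Ball (EFin \o f).
Proof.
move=> mf fg; apply: le_integrable; first exact: measurable_Ball.
  exact/measurable_EFinP.
by move=> x Bx /=; rewrite lee_fin (le_trans (fg x Bx))// ler_norm.
Qed.

Lemma L2_ball_bounded f g : measurable_fun Ball f -> continuous g ->
  (forall x, Ball x -> `|f x| <= `|g x|) -> L2_ball f.
Proof.
move=> mf cg fg; split=> //.
apply: (@le_integrable_Ball (fun x => f x ^+ 2) (fun x => g x ^+ 2)).
- exact: measurable_funX.
- move=> x Bx; rewrite ger0_norm ?sqr_ge0// -real_normK ?num_real//.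
  by rewrite -[leRHS]real_normK ?num_real// lerXn2r ?nnegrE// fg.
- apply: integrable_Ball_continuous => x; exact: (cvgM (cg x) (cg x)).
Qed.

Lemma L2_ball_mul f g : L2_ball f -> L2_ball g ->
  (lebesgue_rV d).-integrable Ball (EFin \o (fun x => f x * g x)).
Proof.
move=> [mf f2] [mg g2].
apply: (@le_integrable_Ball _ (fun x => f x ^+ 2 + g x ^+ 2)).
- exact: measurable_funM.
- move=> x _; rewrite normrM -(real_normK (num_real (f x))).
  rewrite -(real_normK (num_real (g x))).
  move: `|f x| `|g x| (normr_ge0 (f x)) (normr_ge0 (g x)) => a b a0 b0.
  by have := sqr_ge0 (a - b); nra.
- rewrite (_ : _ \o _ = (fun x => (f x ^+ 2)%:E) \+ (fun x => (g x ^+ 2)%:E))%E//.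
  by apply: integrableD => //; exact: measurable_Ball.
Qed.

(** This settles degenerate normalizations: [g] vanishes almost everywhere, and [h] vanishes
    wherever [g] does. *)
Lemma int_ball_eq0 g h : (forall x, Ball x -> 0 <= g x) ->
  (lebesgue_rV d).-integrable Ball (EFin \o g) -> measurable_fun Ball h ->
  (forall x, Ball x -> g x = 0 -> h x = 0) -> int_ball g = 0 -> int_ball h = 0.
Proof.
move=> g0 ig mh gh I0.
have mg := measurable_int _ ig.
have I0' : (\int[lebesgue_rV d]_(x in Ball) `|(EFin \o g) x| = 0)%E.
  rewrite -[RHS]/(0%:E) -I0 /int_ball /Rintegral fineK; last first.
    by apply: integrable_fin_num => //; exact: measurable_Ball.
  by apply: eq_integral => x /set_mem Bx /=; rewrite ger0_norm// g0.
have ae0 := (ae_eq_integral_abs (lebesgue_rV d) (@measurable_Ball R d) mg).1 I0'.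
rewrite /int_ball /Rintegral (@ae_eq_integral _ _ _ _ _ (cst 0%E)) ?integral0//.
- exact: measurable_Ball.
- exact/measurable_EFinP.
- by apply: filterS ae0 => x H Bx; have /= [gx] := H Bx; rewrite gh.
Qed.

End ball_integrals.

(** * Smooth functions with support inside the open ball *)

Section flat_bump.
Context {R : realType} {d : nat} (e : R).
Hypothesis e0 : 0 < e.
Implicit Types (p : 'rV[R]_d -> R).

Definition flat_bump (a : nat) p (x : 'rV[R]_d) : R :=
  p x * flat_exp e a (bubble x - e).

Lemma polyfun_bubbleB : polyfun (fun x : 'rV[R]_d => bubble x - e).
Proof. by apply: polyfunB; [exact: polyfun_bubble|exact: polyfun_cst]. Qed.

Lemma is_derive_flat_exp_bubble a (i : 'I_d) (x : 'rV[R]_d) (l : R) :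
  is_derive x (axis i) (@bubble R d) l ->
  is_derive x (axis i) (fun y => flat_exp e a (bubble y - e))
  ((- a%:R * flat_exp e a.+1 (bubble x - e) +
    e * flat_exp e a.+2 (bubble x - e)) * l).
Proof.
move=> db; apply: (is_derive_comp_axis (flat_exp e a) (fun y => bubble y - e)).
  exact: is_derive_flat_exp.
have H := is_deriveD db (is_derive_cst (- e) x (axis i)).
by rewrite addr0 in H; exact: H.
Qed.

Lemma continuous_flat_bump a p : polyfun p -> continuous (flat_bump a p).
Proof.
move=> pp x; apply: (cvgM (continuous_polyfun _ pp x)).
apply: (@continuous_comp _ _ _ (fun y : 'rV[R]_d => bubble y - e) (flat_exp e a)).
  exact/continuous_polyfun/polyfun_bubbleB.
exact: continuous_flat_exp.
Qed.

(** The product rule yields the exponents a, a + 1 and a + 2; [flat_expS] raises the lower ones at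
    the cost of polynomial factors [bubble x - e]. The shape is thus preserved and all higher
    derivatives follow by iteration. *)
Lemma is_derive_flat_bump a p : polyfun p -> forall i : 'I_d, exists2 p',
  polyfun p' & forall x, is_derive x (axis i) (flat_bump a p) (flat_bump a.+2 p' x).
Proof.
move=> pp i; have [dp [pdp pD]] := polyfun_derive _ pp.
have [db [pdb bD]] := polyfun_derive _ (@polyfun_bubble R d).
exists (fun x => dp i x * (bubble x - e) ^+ 2 +
    p x * ((- a%:R * (bubble x - e) + e) * db i x)).
  apply: polyfunD.
    by apply: polyfunM => //; apply: polyfunX; exact: polyfun_bubbleB.
  apply: polyfunM => //; apply: polyfunM => //; apply: polyfunD.
    by apply: polyfunM; [exact: polyfun_cst|exact: polyfun_bubbleB].
  exact: polyfun_cst.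
move=> x; have := is_deriveM (pD i x) (is_derive_flat_exp_bubble a i x _ (bD i x)).
move=> H; apply: (is_derive_eq H); rewrite /flat_bump /GRing.scale/=.
rewrite -(flat_expS _ a) -(flat_expS _ a.+1); ring.
Qed.

Lemma cont_diff_flat_bump k a p : polyfun p -> cont_diff k setT (flat_bump a p).
Proof.
elim: k a p => [|k IH] a p pp /=.
  by split=> //; apply: continuous_subspaceT; exact: continuous_flat_bump.
split; first by apply: continuous_subspaceT; exact: continuous_flat_bump.
move=> i; have [p' pp' dp'] := is_derive_flat_bump a p pp i.
by exists (flat_bump a.+2 p') => [x _|]; [exact: dp'|exact: IH].
Qed.

Lemma test_function_flat_bump a p : polyfun p -> test_function (flat_bump a p).
Proof.
move=> pp; split=> [k|]; first exact: cont_diff_flat_bump.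
have cl : closed [set x : 'rV[R]_d | e <= bubble x].
  rewrite (_ : [set x | _] = @bubble R d @^-1` [set y | e <= y])//.
  apply: preimage_closed => [x _|]; last exact: closed_ge.
  exact/continuous_polyfun/polyfun_bubble.
(* The support lies in the closed set where 1 - |x|^2 >= e, which stays away from the sphere. *)
apply: (@subset_trans _ [set x | e <= bubble x]); last first.
  by move=> x /= ex; apply/openBallE/(lt_le_trans e0).
rewrite [X in _ `<=` X](closure_id _).1//; apply: closure_subset => x /=.
apply: contra_neqP => /negP; rewrite -ltNge => xe.
by rewrite /flat_bump flat_exp_le0 ?mulr0// subr_le0 ltW.
Qed.

End flat_bump.

(** * Integration by parts against test functions *)

Section test_functions.
Context {R : realType} {d : nat}.
Implicit Types (phi v : 'rV[R]_d -> R) (x : 'rV[R]_d) (i : 'I_d).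

Lemma test_function_supp phi x : test_function phi -> ~ openBall x -> phi x = 0.
Proof.
move=> [_ sub] xB; apply: contrapT => /eqP phix; apply/xB/sub.
exact: subset_closure.
Qed.

Lemma test_function_derive_supp phi x i : test_function phi -> ~ openBall x ->
  'D_(axis i) phi x = 0.
Proof.
move=> [_ sub] xB.
rewrite (@near_eq_derive _ _ _ _ (cst 0)) ?derive_cst//.
have : (~` closure [set y | phi y != 0]) x by move/sub.
move=> xc; have := open_nbhs_nbhs (conj (closed_openC (@closed_closure _ _)) xc).
apply: filterS => y /= yc; apply: contrapT => /eqP phiy; apply: yc.
exact: subset_closure.
Qed.

Lemma continuous_test_function phi : test_function phi -> continuous phi.
Proof. by move=> [cd _]; have [cphi _] := cd 0%N; exact/continuous_subspace_setT. Qed.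

Lemma test_function_derive phi i : test_function phi ->
  continuous ('D_(axis i) phi) /\
  forall x, is_derive x (axis i) phi ('D_(axis i) phi x).
Proof.
move=> [cd _]; have [_ /(_ i)[g dg [cg _]]] := cd 1%N.
have gEx x : 'D_(axis i) phi x = g x.
  have [|_ ->//] := dg x; by rewrite interiorT.
have gE : 'D_(axis i) phi = g by apply/funext.
split; first by rewrite gE; exact/continuous_subspace_setT.
by move=> x; rewrite gEx; apply: dg; rewrite interiorT.
Qed.

Lemma int_ball_setT (h : 'rV[R]_d -> R) : (forall x, ~ openBall x -> h x = 0) ->
  int_ball h = fine (\int[lebesgue_rV d]_x (h x)%:E)%E.
Proof.
move=> h0; rewrite /int_ball /Rintegral integral_mkcond; congr fine.
apply: eq_integral => x _; rewrite patchE; case: ifPn => // /negP.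
rewrite inE => Bx; rewrite h0// => /openBallE b; apply: Bx; exact/BallE/ltW.
Qed.

(** The sum of the two integrands is the partial derivative of v phi, which vanishes off the open
    ball, so its integral over the whole space is 0. *)
Lemma integration_by_parts_ball v (dv : 'I_d -> 'rV[R]_d -> R) phi i :
  continuous v -> continuous (dv i) ->
  (forall x, is_derive x (axis i) v (dv i x)) -> test_function phi ->
  int_ball (fun x => v x * 'D_(axis i) phi x) =
  - int_ball (fun x => dv i x * phi x).
Proof.
move=> cv cdv dvE tphi.
have [cdphi dphi] := test_function_derive phi i tphi.
have cphi := continuous_test_function phi tphi.
have c1 : continuous (fun x => v x * 'D_(axis i) phi x).
  by move=> x; exact: (cvgM (cv x) (cdphi x)).
have c2 : continuous (fun x => dv i x * phi x).
  by move=> x; exact: (cvgM (cdv x) (cphi x)).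
apply/eqP; rewrite -addr_eq0; apply/eqP.
rewrite /int_ball -RintegralD; first last.
- exact: integrable_Ball_continuous.
- exact: integrable_Ball_continuous.
- exact: measurable_Ball.
rewrite -/(int_ball _) int_ball_setT; last first.
  move=> x xB; rewrite (test_function_derive_supp phi)// (test_function_supp phi)//.
  by rewrite !mulr0 addr0.
have out (x : 'rV[R]_d) j : 1 <= `|x 0 j| -> ~ openBall x.
  by move=> x1 /(openBall_coord _ j); rewrite ltNge x1.
rewrite [X in fine X](_ : _ = 0%E)//.
apply: (int_partial_eq0 d i (fun x => v x * phi x)).
- move=> x; have := is_deriveM (dvE x) (dphi x).
  by move=> H; apply: (is_derive_eq H); rewrite /GRing.scale/= [phi x * _]mulrC.
- by move=> x; exact: (cvgD (c1 x) (c2 x)).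
- by move=> x j /out xB; rewrite (test_function_supp phi)// mulr0.
- move=> x j /ltW/out xB; rewrite (test_function_supp phi)// mulr0.
  by rewrite (test_function_derive_supp phi)// mulr0 addr0.
Qed.

End test_functions.

(** * Membership in H^1_0 and weak solutions *)

Section mollified_identity.
Context {R : realType}.
Implicit Types (e s b : R).

(* s e^(-e/s) for s > 0, and its derivative in s, both extended by 0. *)
Definition moll e s : R := s * flat_exp e 0 s.
Definition moll' e s : R := flat_exp e 0 s + e * flat_exp e 1 s.

Lemma moll_norm_le1 e s : 0 < e -> s <= 1 -> `|moll e s| <= 1.
Proof.
move=> e0 s1; have [s0|s0] := ltP 0 s; last first.
  by rewrite /moll flat_exp_le0// mulr0 normr0.
rewrite /moll flat_exp_gt0// expr0 mul1r ger0_norm ?mulr_ge0 ?expR_ge0 ?(ltW s0)//.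
rewrite -[X in _ <= X]mulr1; apply: ler_pM; rewrite ?expR_ge0// ?(ltW s0)//.
by rewrite -expR0 ler_expR oppr_le0 divr_ge0// ltW.
Qed.

(** For s > 0 this is (1 + e/s) exp(-e/s) <= 1. The bound is uniform in e, as domination
    requires. *)
Lemma moll'_norm_le1 e s : 0 < e -> `|moll' e s| <= 1.
Proof.
move=> e0; have [s0|s0] := ltP 0 s; last first.
  by rewrite /moll' !flat_exp_le0// mulr0 addr0 normr0.
rewrite /moll' !flat_exp_gt0// expr0 expr1 mul1r mulrA.
rewrite -[X in X + _]mul1r -mulrDl expRN.
have es : 0 < e / s by rewrite divr_gt0.
rewrite ger0_norm; last by rewrite mulr_ge0 ?invr_ge0 ?expR_ge0// addr_ge0// ltW.
by rewrite ler_pdivrMr ?expR_gt0// mul1r expR_ge1Dx.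
Qed.

Lemma cvg_flat_exp a b : 0 < b ->
  flat_exp m.+1%:R^-1 a (b - m.+1%:R^-1) @[m --> \oo] --> b^-1 ^+ a.
Proof.
move=> b0; have h0 := @cvg_harmonic R.
have sb : (b - m.+1%:R^-1) @[m --> \oo] --> b.
  by rewrite -[X in _ --> X]subr0; apply: cvgB => //; exact: cvg_cst.
have sV : (b - m.+1%:R^-1)^-1 @[m --> \oo] --> b^-1.
  by apply: cvgV => //; exact: lt0r_neq0.
have s0 : \forall m \near \oo, 0 < b - m.+1%:R^-1.
  exact: (cvgr_gt b sb).
apply: (@cvg_trans _ (((b - m.+1%:R^-1)^-1 ^+ a *
    expR (- (m.+1%:R^-1 * (b - m.+1%:R^-1)^-1))) @[m --> \oo])).
  by apply: near_eq_cvg; near=> m; rewrite flat_exp_gt0//; near: m.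
rewrite -[b^-1 ^+ a]mulr1; apply: cvgM.
  by apply: (cvg_comp _ (fun r : R => r ^+ a) sV); exact: exprn_continuous.
have c0 : (- (m.+1%:R^-1 * (b - m.+1%:R^-1)^-1)) @[m --> \oo] --> - (0 * b^-1).
  by apply: cvgN; exact: (cvgM h0 sV).
have := cvg_comp _ _ c0 (@continuous_expR R _).
by rewrite mul0r oppr0 expR0.
Unshelve. all: by end_near. Qed.

Lemma cvg_moll b : 0 <= b ->
  moll m.+1%:R^-1 (b - m.+1%:R^-1) @[m --> \oo] --> b.
Proof.
rewrite le_eqVlt => /predU1P[<-|b0].
  rewrite (_ : (fun _ => _) = cst 0); first exact: cvg_cst.
  by apply/funext => m; rewrite /moll flat_exp_le0 ?mulr0// sub0r oppr_le0 invr_ge0.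
rewrite -[X in _ --> X]mulr1; apply: cvgM; last first.
  by have := cvg_flat_exp 0 b b0; rewrite expr0.
rewrite -[X in _ --> X]subr0; apply: cvgB; first exact: cvg_cst.
exact: cvg_harmonic.
Qed.

(** At b = 0 the argument is negative for every m, so the limit is 0 there and 1 for b > 0. *)
Lemma cvg_moll' b : 0 <= b ->
  moll' m.+1%:R^-1 (b - m.+1%:R^-1) @[m --> \oo] --> ((0 < b)%R%:R : R).
Proof.
rewrite le_eqVlt => /predU1P[<-|b0].
  rewrite ltxx (_ : (fun _ => _) = cst 0); first exact: cvg_cst.
  apply/funext => m; rewrite /moll' !flat_exp_le0 ?mulr0 ?addr0//;
  by rewrite sub0r oppr_le0 invr_ge0.
rewrite b0 -[X in _ --> X]addr0 -[X in _ --> _ + X](mul0r (b^-1 ^+ 1)); apply: cvgD.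
  by have := cvg_flat_exp 0 b b0; rewrite expr0.
by apply: cvgM; [exact: cvg_harmonic|exact: cvg_flat_exp].
Qed.

End mollified_identity.

(** * Polynomial multiples of 1 - |x|^2 belong to H^1_0 *)

Section bubble_H1_0.
Context {R : realType} {d : nat} (p : 'rV[R]_d -> R) (pp : polyfun p).
Implicit Types (x : 'rV[R]_d) (i : 'I_d) (m : nat).
Let v x : R := bubble x * p x.
Variables (db dp : 'I_d -> 'rV[R]_d -> R).
Hypotheses (pdb : forall i, polyfun (db i)) (pdp : forall i, polyfun (dp i)).
Hypothesis dbE : forall i x, is_derive x (axis i) (@bubble R d) (db i x).
Hypothesis dpE : forall i x, is_derive x (axis i) p (dp i x).

Let pv : polyfun v.
Proof. by apply: polyfunM => //; exact: polyfun_bubble. Qed.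

Let dv i x : R := bubble x * dp i x + p x * db i x.

Let pdv i : polyfun (dv i).
Proof. by apply: polyfunD; apply: polyfunM => //; exact: polyfun_bubble. Qed.

Let dvE i x : is_derive x (axis i) v (dv i x).
Proof. exact: (is_deriveM (dbE i x) (dpE i x)). Qed.

(* Truncated to 0 on the sphere, so that the approximation below converges at
   every point of the closed ball. *)
Let G x : 'rV[R]_d := \row_i ((0 < bubble x)%R%:R * dv i x).

Let measurable_bubble_gt0 :
  measurable_fun [set: 'rV[R]_d] (fun x => (0 < bubble x)%R%:R : R).
Proof.
rewrite (_ : (fun _ => _) = \1_(@openBall R d)); last first.
  apply/funext => x; rewrite indicE; congr (_%:R); congr nat_of_bool.
  by apply/idP/idP => [/openBallE/mem_set//|/set_mem/openBallE].
apply: measurable_indic; rewrite (_ : openBall = @bubble R d @^-1` [set y | 0 < y]).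
  apply: open_measurable_rV.
  have /continuousP := continuous_polyfun _ (@polyfun_bubble R d).
  by apply; exact: open_gt.
by apply/seteqP; split=> x /openBallE.
Qed.

Let measurable_G i : measurable_fun [set: 'rV[R]_d] (fun x => G x 0 i).
Proof.
under eq_fun do rewrite mxE.
apply: measurable_funM; first exact: measurable_bubble_gt0.
apply: continuous_measurable_rV; exact: continuous_polyfun.
Qed.

(** [G] is the classical gradient in the open ball, and test functions vanish where the truncation
    acts. *)
Lemma weak_gradient_bubble : weak_gradient v G.
Proof.
split=> [i|phi tphi i].
  apply: (L2_ball_bounded _ (dv i)).
  - exact: measurable_funTS.
  - exact: continuous_polyfun.
  - by move=> x _; rewrite mxE normrM ler_piMl// normr_nat lern1 leq_b1.
rewrite (integration_by_parts_ball v dv)//; try exact: continuous_polyfun.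
congr (- _); apply: eq_Rintegral => x _; rewrite mxE.
case: ltP => [|xb]; first by rewrite mul1r.
by rewrite (test_function_supp phi)// ?mulr0// => /openBallE; rewrite ltNge xb.
Qed.

Let phi m := flat_bump m.+1%:R^-1 0 (fun x => p x * (bubble x - m.+1%:R^-1)).

Let test_phi m : test_function (phi m).
Proof.
apply: test_function_flat_bump; first by rewrite invr_gt0.
by apply: polyfunM => //; exact: polyfun_bubbleB.
Qed.

Let phiE m x : phi m x = p x * moll m.+1%:R^-1 (bubble x - m.+1%:R^-1).
Proof. by rewrite /phi /flat_bump /moll mulrA. Qed.

Let dphiE m x i : 'D_(axis i) (phi m) x =
  dp i x * moll m.+1%:R^-1 (bubble x - m.+1%:R^-1) +
  p x * (moll' m.+1%:R^-1 (bubble x - m.+1%:R^-1) * db i x).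
Proof.
set e : R := m.+1%:R^-1; have e0 : 0 < e by rewrite invr_gt0.
have db' : is_derive x (axis i) (fun y => bubble y - e) (db i x).
  have H := is_deriveD (dbE i x) (is_derive_cst (- e) x (axis i)).
  by rewrite addr0 in H; exact: H.
have [_ ->] := is_deriveM (is_deriveM (dpE i x) db')
  (is_derive_flat_exp_bubble e e0 0 i x _ (dbE i x)).
rewrite /moll /moll' /GRing.scale/= mulr0n oppr0 mul0r add0r !fctE.
rewrite -(flat_expS e 0) -(flat_expS e 1); ring.
Qed.

Let err m x : R := (v x - phi m x) ^+ 2 +
  dot (G x - grad (phi m) x) (G x - grad (phi m) x).

(** A continuous majorant of [err m] independent of m, obtained by bounding [moll], [moll'] and
    [bubble] by 1 in absolute value on the ball. *)
Let dom x : R := (`|p x| + `|p x|) ^+ 2 +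
  \sum_(i < d) (`|dv i x| + (`|dp i x| + `|p x| * `|db i x|)) ^+ 2.

Let continuous_dom : continuous dom.
Proof.
have cn f : polyfun f -> continuous (fun x : 'rV[R]_d => `|f x|).
  move=> pf x; apply: continuous_comp; first exact: continuous_polyfun.
  exact: norm_continuous.
have cD (f g : 'rV[R]_d -> R) : continuous f -> continuous g ->
    continuous (fun x => f x + g x).
  by move=> cf cg x; exact: (cvgD (cf x) (cg x)).
have cM (f g : 'rV[R]_d -> R) : continuous f -> continuous g ->
    continuous (fun x => f x * g x).
  by move=> cf cg x; exact: (cvgM (cf x) (cg x)).
have cS (r : seq 'I_d) (F : 'I_d -> 'rV[R]_d -> R) : (forall i, continuous (F i)) ->
    continuous (fun x => \sum_(i <- r) F i x).
  move=> cF; elim: r => [|i r IH].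
    by under eq_fun do rewrite big_nil; exact: cst_continuous.
  by under eq_fun do rewrite big_cons; exact: cD.
apply: (cD); first by apply: (cM); apply: (cD); exact: cn.
apply: cS => i.
have ci : continuous (fun x => `|dv i x| + (`|dp i x| + `|p x| * `|db i x|)).
  by apply: (cD); [exact: cn|apply: (cD); [exact: cn|apply: (cM); exact: cn]].
exact: cM.
Qed.

Let bubble_le1 x : bubble x <= 1 :> R.
Proof. by rewrite bubbleE gerBl dot_ge0. Qed.

Let errE m x : err m x = (bubble x * p x -
    p x * moll m.+1%:R^-1 (bubble x - m.+1%:R^-1)) ^+ 2 +
  \sum_(i < d) ((0 < bubble x)%R%:R * dv i x -
    (dp i x * moll m.+1%:R^-1 (bubble x - m.+1%:R^-1) +
     p x * (moll' m.+1%:R^-1 (bubble x - m.+1%:R^-1) * db i x))) ^+ 2.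
Proof.
rewrite /err phiE; congr (_ + _); apply: eq_bigr => i _.
by rewrite -expr2 !mxE dphiE.
Qed.

Let err_le m x : Ball x -> `|err m x| <= dom x.
Proof.
move=> /BallE b0; rewrite errE ger0_norm; last first.
  by rewrite addr_ge0 ?sqr_ge0// sumr_ge0// => i _; rewrite sqr_ge0.
have e0 : 0 < m.+1%:R^-1 :> R by rewrite invr_gt0.
have s1 : bubble x - m.+1%:R^-1 <= 1 by rewrite lerBlDr ler_wpDr// ltW.
have A1 := moll_norm_le1 m.+1%:R^-1 (bubble x - m.+1%:R^-1) e0 s1.
have B1 := moll'_norm_le1 m.+1%:R^-1 (bubble x - m.+1%:R^-1) e0.
move: (moll _ _) (moll' _ _) A1 B1 => A B A1 B1.
have sq (a b : R) : `|a| <= b -> a ^+ 2 <= b ^+ 2.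
  move=> ab; rewrite -[a ^+ 2]real_normK ?num_real// lerXn2r ?nnegrE//.
  exact: le_trans (normr_ge0 _) ab.
apply: lerD.
  apply: sq; apply: le_trans (ler_normB _ _) _; rewrite !normrM; apply: lerD.
    by rewrite ler_piMl// ger0_norm.
  by rewrite ler_piMr.
apply: ler_sum => i _; apply: sq; apply: le_trans (ler_normB _ _) _.
apply: lerD; first by rewrite normrM ler_piMl// normr_nat lern1 leq_b1.
apply: le_trans (ler_normD _ _) _; rewrite !normrM; apply: lerD.
  by rewrite ler_piMr.
by rewrite ler_wpM2l// ler_piMl.
Qed.

Let err_cvg x : Ball x -> err m x @[m --> \oo] --> (0 : R).
Proof.
move=> /BallE b0.
have cA := cvg_moll _ b0; have cB := cvg_moll' _ b0.
have sq (u : nat -> R) : u m @[m --> \oo] --> (0 : R) ->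
    (u m) ^+ 2 @[m --> \oo] --> (0 : R).
  by move=> u0; rewrite -[X in _ --> X](mul0r 0); exact: (cvgM u0 u0).
rewrite (_ : err^~ x = fun m => (bubble x * p x -
    p x * moll m.+1%:R^-1 (bubble x - m.+1%:R^-1)) ^+ 2 +
  \sum_(i < d) ((0 < bubble x)%R%:R * dv i x -
    (dp i x * moll m.+1%:R^-1 (bubble x - m.+1%:R^-1) +
     p x * (moll' m.+1%:R^-1 (bubble x - m.+1%:R^-1) * db i x))) ^+ 2); last first.
  by apply/funext => m; rewrite errE.
rewrite -[X in _ --> X]addr0; apply: cvgD.
  apply: sq; rewrite -[X in _ --> X](subrr (bubble x * p x)).
  apply: cvgB; first exact: cvg_cst.
  by rewrite [X in _ --> X]mulrC; apply: cvgM => //; exact: cvg_cst.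
have z : \sum_(i < d) (0 : R) = 0 by rewrite big1.
rewrite -[X in _ --> X]z.
apply: cvg_big; first exact: add_continuous.
move=> i _; apply: sq; rewrite -[X in _ --> X](subrr ((0 < bubble x)%R%:R * dv i x)).
apply: cvgB; first exact: cvg_cst.
(* The limit of the approximating partial derivatives: the product rule inside the ball, and 0 on
   the sphere, where [bubble x] vanishes. *)
rewrite (_ : _%:R * dv i x = dp i x * bubble x + p x * ((0 < bubble x)%R%:R * db i x)).
  apply: cvgD; first by apply: cvgM => //; exact: cvg_cst.
  apply: cvgM; first exact: cvg_cst.
  by apply: cvgM => //; exact: cvg_cst.
rewrite /dv; move: b0; rewrite le_eqVlt => /predU1P[<-|->]; last by rewrite !mul1r mulrC.
by rewrite ltxx !mul0r !mulr0 addr0.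
Qed.

Let measurable_err m : measurable_fun Ball (err m).
Proof.
apply: measurable_funTS; apply: measurable_funD.
  apply: measurable_funX; apply: measurable_funB.
    apply: continuous_measurable_rV; exact: continuous_polyfun.
  apply: continuous_measurable_rV; exact: continuous_test_function.
apply: measurable_sum => i.
have mG : measurable_fun [set: 'rV[R]_d] (fun x => (G x - grad (phi m) x) 0 i).
  rewrite (_ : (fun _ => _) = fun x => G x 0 i - 'D_(axis i) (phi m) x).
    apply: measurable_funB; first exact: measurable_G.
    by apply: continuous_measurable_rV; have [] := test_function_derive _ i (test_phi m).
  by apply/funext => x; rewrite !mxE.
exact: measurable_funM.
Qed.

Lemma H1_0_bubble_mul : H1_0 v.
Proof.
split.
  apply: (L2_ball_bounded v v) => //; last exact: continuous_polyfun.
  by apply: measurable_funTS; apply: continuous_measurable_rV; exact: continuous_polyfun.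
exists G, phi; split; [exact: weak_gradient_bubble|exact: test_phi|].
rewrite -/(err _); have mB := @measurable_Ball R d.
have [] := @dominated_convergence _ _ _ (lebesgue_rV d) Ball mB
  (fun m x => (err m x)%:E) (cst 0%E) (fun x => (dom x)%:E).
- by move=> m; exact/measurable_EFinP.
- exact: measurable_cst.
- apply: aeW => x Bx; apply/fine_cvgP; split; first exact: nearW.
  exact: err_cvg.
- exact: integrable_Ball_continuous.
- by apply: aeW => x m Bx /=; rewrite lee_fin; exact: err_le.
move=> _ _; rewrite integral0 => /fine_cvgP[_]; exact.
Qed.

End bubble_H1_0.

(** * Testing the variational formulation *)

Section weak_solution_theory.
Context {R : realType} {d : nat} (lam : R) (kap : nat).
Implicit Types (f u v p : 'rV[R]_d -> R).

Lemma H1_0_bubble p : polyfun p -> H1_0 (fun x => bubble x * p x).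
Proof.
move=> pp; have [dp [pdp dpE]] := polyfun_derive _ pp.
have [db [pdb dbE]] := polyfun_derive _ (@polyfun_bubble R d).
exact: (H1_0_bubble_mul _ pp db dp).
Qed.

(** Membership in H^1_0 supplies a weak gradient, so the default value of [xget] is not reached. *)
Lemma weak_gradient_wgrad u : H1_0 u -> weak_gradient u (wgrad u).
Proof.
move=> [_ [G [_ [wG _ _]]]]; rewrite /wgrad.
by case: xgetP => [? -> //|/(_ G)].
Qed.

Lemma measurable_bubbleX (D : set 'rV[R]_d) :
  measurable_fun D (fun x => bubble x ^+ kap).
Proof.
apply: measurable_funTS; apply: continuous_measurable_rV.
by apply: continuous_polyfun; apply: polyfunX; exact: polyfun_bubble.
Qed.

Lemma integrable_mass u v : L2_ball u -> L2_ball v ->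
  (lebesgue_rV d).-integrable Ball
    (EFin \o (fun x => u x * v x * bubble x ^+ kap)).
Proof.
move=> Lu Lv; have iuv := L2_ball_mul _ _ Lu Lv.
apply: (@le_integrable_Ball _ _ _ (fun x => `|u x * v x|)).
- apply: measurable_funM; last exact: measurable_bubbleX.
  by case: Lu Lv => mu _ [mv _]; exact: measurable_funM.
- move=> x /BallE b0; rewrite normrM ler_piMr//.
  rewrite normrX exprn_ile1// ger0_norm//.
  by rewrite bubbleE gerBl dot_ge0.
- exact: integrable_norm.
Qed.

Lemma integrable_dot_wgrad u v : H1_0 u -> H1_0 v ->
  (lebesgue_rV d).-integrable Ball (EFin \o (fun x => dot (wgrad u x) (wgrad v x))).
Proof.
move=> /weak_gradient_wgrad[Lu _] /weak_gradient_wgrad[Lv _].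
rewrite (_ : _ \o _ = (fun x => \sum_(i < d) (wgrad u x 0 i * wgrad v x 0 i)%:E)%E).
  apply: integrable_sum => [|i _]; first exact: measurable_Ball.
  exact: L2_ball_mul.
by apply/funext => x; rewrite /= sumEFin.
Qed.

(** The formulation has one integral where the Sobolev product has two; integrability of both parts
    allows the splitting. *)
Lemma sobolev_ip_weak_solution f u v : weak_solution lam kap f u -> H1_0 v ->
  sobolev_ip lam kap u v = int_ball (fun x => f x * v x).
Proof.
move=> [Hu solu] Hv; rewrite -(solu v Hv) /sobolev_ip /int_ball.
have im := integrable_mass u v Hu.1 Hv.1; have mB := @measurable_Ball R d.
rewrite -RintegralZl// addrC -RintegralD//.
- by apply: eq_Rintegral => x _; rewrite !mulrA.
- exact: integrable_dot_wgrad.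
- rewrite (_ : _ \o _ = (fun x => lam%:E *
      (EFin \o (fun x => u x * v x * bubble x ^+ kap)%R) x)%E).
    exact: integrableZl.
  by apply/funext => x.
Qed.

(** The mass term must vanish, so almost everywhere [v] or [bubble] is 0, and either forces v = 0.
    The hypothesis is an inequality because [Num.sqrt] is also 0 at negative arguments. *)
Lemma sobolev_ip_eq0 f v : 0 < lam -> H1_0 v -> measurable_fun Ball f ->
  (forall x, bubble x = 0 -> v x = 0) ->
  sobolev_ip lam kap v v <= 0 -> int_ball (fun x => f x * v x) = 0.
Proof.
move=> lam0 Hv mf v0 ip0.
have g0 x : Ball x -> 0 <= v x * v x * bubble x ^+ kap.
  by move=> /BallE b0; rewrite mulr_ge0 ?exprn_ge0// -expr2 sqr_ge0.
apply: (int_ball_eq0 (fun x => v x * v x * bubble x ^+ kap)) => //.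
- exact: integrable_mass Hv.1 Hv.1.
- by apply: measurable_funM => //; case: Hv => -[].
- move=> x Bx /eqP; rewrite mulf_eq0 mulf_eq0 orbb => /orP[/eqP->|].
    by rewrite mulr0.
  rewrite expf_eq0 => /andP[_ /eqP b0]; by rewrite v0 ?mulr0.
- have I1 : 0 <= int_ball (fun x => v x * v x * bubble x ^+ kap) by exact: Rintegral_ge0.
  have I2 : 0 <= int_ball (fun x => dot (wgrad v x) (wgrad v x)).
    by apply: Rintegral_ge0 => x _; exact: dot_ge0.
  apply/eqP; rewrite eq_le I1 andbT -(pmulr_rle0 _ lam0).
  by move: ip0; rewrite /sobolev_ip; lra.
Qed.

Lemma ftildeE f q Y u n j nu : 0 < lam -> measurable_fun Ball f ->
  weak_solution lam kap f u ->
  ftilde lam kap q Y u n j nu = int_ball (fun x => f x * sob_poly q Y n j nu x).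
Proof.
move=> lam0 mf solu; set v := sob_poly q Y n j nu.
have Hv : H1_0 v := H1_0_bubble _ (polyfun_ball_poly q Y n j nu).
rewrite /ftilde /uhat -(sobolev_ip_weak_solution f u v)// -/v.
(* Division by 0 yields 0, so in the degenerate case the integral of f v has to be shown to
   vanish. *)
have [N0|N0] := eqVneq (sobolev_norm lam kap v ^+ 2) 0; last by rewrite divfK.
rewrite N0 mulr0 (sobolev_ip_weak_solution f)// (sobolev_ip_eq0 f v)//.
  by move=> x x0; rewrite /v /sob_poly x0 mul0r.
by move: N0 => /eqP; rewrite expf_eq0/= sqrtr_eq0.
Qed.

Lemma fhatE f P Y n k nu : measurable_fun Ball f ->
  fhat P Y f n k nu * norm1 P Y n k nu =
  b1 d * int_ball (fun x => f x * ball_poly P Y n k nu x * bubble x).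
Proof.
move=> mf; set p := ball_poly P Y n k nu.
have pp : polyfun p := polyfun_ball_poly P Y n k nu.
rewrite /fhat -/p -[RHS]/(ip1 f p).
have [N0|N0] := eqVneq (norm1 P Y n k nu) 0; last by rewrite divfK.
rewrite N0 mulr0; apply/esym; move: N0; rewrite /norm1 /ip1 -/p => /eqP.
rewrite mulf_eq0 => /orP[/eqP->|/eqP I0]; first by rewrite mul0r.
rewrite (int_ball_eq0 (fun x => p x * p x * bubble x)) ?mulr0//.
- by move=> x /BallE b0; rewrite mulr_ge0// -expr2 sqr_ge0.
- apply: integrable_Ball_continuous; apply: continuous_polyfun.
  by apply: polyfunM; [exact: polyfunM|exact: polyfun_bubble].
- apply: measurable_funM; last first.
    apply: measurable_funTS; apply: continuous_measurable_rV.
    by apply: continuous_polyfun; exact: polyfun_bubble.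
  apply: measurable_funM => //.
  by apply: measurable_funTS; apply: continuous_measurable_rV; exact: continuous_polyfun.
- move=> x _ /eqP; rewrite mulf_eq0 mulf_eq0 orbb => /orP[]/eqP ->.
    by rewrite mulr0 mul0r.
  by rewrite mulr0.
Qed.

(** Integrability and value are proved together, since splitting off a summand needs the rest to be
    integrable. *)
Lemma int_ball_sum (r : seq nat) (c : nat -> R) (F : nat -> 'rV[R]_d -> R) :
  (forall j, (lebesgue_rV d).-integrable Ball (EFin \o F j)) ->
  (lebesgue_rV d).-integrable Ball (EFin \o (fun x => \sum_(j <- r) c j * F j x)) /\
  int_ball (fun x => \sum_(j <- r) c j * F j x) =
  \sum_(j <- r) c j * int_ball (F j).
Proof.
move=> iF; have mB := @measurable_Ball R d.
have icF j : (lebesgue_rV d).-integrable Ball (EFin \o (fun x => c j * F j x)).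
  exact: (integrableZl mB (c j) (iF j)).
elim: r => [|j r [IHi IH]].
  rewrite big_nil; under eq_fun do rewrite big_nil.
  split; last by rewrite /int_ball Rintegral_cst// mul0r.
  by apply: integrable_Ball_continuous; exact: cst_continuous.
rewrite big_cons; under eq_fun do rewrite big_cons; split.
  exact: (integrableD mB (icF j) IHi).
by rewrite -IH /int_ball -RintegralZl// -RintegralD.
Qed.

End weak_solution_theory.

(** * The coefficient formula and the recursion on the ball *)

Theorem mainTheorem3 (R : realType) (d : nat) (hd : (2 <= d)%N)
  (lam : R) (hlam : 0 < lam) (kap : nat)
  (a : nat -> nat) (Y : nat -> nat -> mpoly d R)
  (hY : forall l : nat, harmonic_onb l (a l) (Y l))
  (P : R -> nat -> {poly R})
  (hP : forall beta : R, -1 < beta -> jacobi_family 1 beta (P beta))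
  (q : R -> nat -> {poly R})
  (hq : forall beta : R, -1 < beta ->
          univ_family lam kap beta (P beta) (q beta))
  (m : nat) (hm : (1 <= m)%N) (f : 'rV[R]_d -> R) (hf : cont_diff m Ball f)
  (u : 'rV[R]_d -> R) (hu : weak_solution lam kap f u) :
  (forall n j nu : nat, (j <= n./2)%N -> (1 <= nu <= a (n - 2 * j))%N ->
     ftilde lam kap q Y u n j nu =
     int_ball (fun x => f x * (1 - enorm x ^+ 2) * ball_poly q Y n j nu x)) /\
  (forall n k nu : nat, (k <= n./2)%N -> (1 <= nu <= a (n - 2 * k))%N ->
     let beta := (n - 2 * k)%:R + (d%:R - 2) / 2 in
     fhat P Y f n k nu * norm1 P Y n k nu =
     b1 d * (ftilde lam kap q Y u n k nu +
             \sum_(k - kap.+1 <= j < k)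
               conn_coef lam kap beta (P beta) (q beta) k j *
               ftilde lam kap q Y u (n - 2 * (k - j)) j nu)).
Proof.
have cf : {within Ball, continuous f} by case: m hf {hm} => [|m] [].
have mf : measurable_fun Ball f.
  by apply: within_continuous_measurable_rV => //; exact: measurable_Ball.
have ftE n j nu := @ftildeE _ _ _ _ f q Y u n j nu hlam mf hu.
split=> [n j nu _ _|n k nu kn _ beta].
  by rewrite ftE; apply: eq_Rintegral => x _; rewrite mulrA.
(* From d >= 2; the weight (1 + t)^beta is then continuous on [-1, 1]. *)
have beta0 : 0 <= beta.
  by rewrite addr_ge0// divr_ge0// subr_ge0 ler_nat.
have beta1 : -1 < beta by apply: lt_le_trans beta0; rewrite ltrN10.
have PqE := jacobi_connection _ _ _ _ _ hlam beta0 (hP _ beta1) (hq _ beta1) k.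
rewrite fhatE//; congr (_ * _).
pose F j x := f x * sob_poly q Y (n - 2 * (k - j)) j nu x.
have iF j : (lebesgue_rV d).-integrable Ball (EFin \o F j).
  have cv : {within Ball, continuous (sob_poly q Y (n - 2 * (k - j)) j nu)}.
    apply: continuous_subspaceT; apply: continuous_polyfun.
    by apply: polyfunM; [exact: polyfun_bubble|exact: polyfun_ball_poly].
  by apply: integrable_Ball => x; exact: (cvgM (cf x) (cv x)).
have [iS SE] := int_ball_sum (index_iota (k - kap.+1) k)
  (conn_coef lam kap beta (P beta) (q beta) k) F iF.
under eq_bigr do rewrite ftE; rewrite ftE -SE.
(* Since n - 2(k - j) - 2j = n - 2k, every term carries the same harmonic and the same beta as the
   left-hand side; j <= k keeps the truncated subtraction exact. *)
have FE j x : (j <= k)%N -> F j x = f x *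
    ((q beta j).[2 * enorm x ^+ 2 - 1] * mpoly_at (Y (n - 2 * k)%N nu) x) * bubble x.
  move=> jk; rewrite /F /sob_poly /ball_poly /beta_of.
  have -> : (n - 2 * (k - j) - 2 * j = n - 2 * k)%N.
    by rewrite -subnDA -mulnDr subnK.
  by rewrite -/beta -mulrA; congr (_ * _); rewrite mulrC.
have -> : (fun x => f x * sob_poly q Y n k nu x) = F k.
  by apply/funext => x; rewrite /F subnn muln0 subn0.
rewrite /int_ball -RintegralD//; last exact: measurable_Ball.
(* The integrands agree pointwise: this is the connection identity evaluated at 2|x|^2 - 1,
   multiplied by f, the harmonic and 1 - |x|^2. *)
apply: eq_Rintegral => x _; rewrite FE//.
rewrite /ball_poly /beta_of -/beta PqE hornerD horner_sum.
under [in RHS]eq_big_nat => j /andP[_ /ltnW jk] do rewrite FE//.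
move: (2 * enorm x ^+ 2 - 1) (bubble x) (mpoly_at _ x) (f x) => t b y z.
rewrite mulrDl mulrDr mulrDl; congr (_ + _).
rewrite mulr_suml mulr_sumr mulr_suml; apply: eq_bigr => j _.
by rewrite hornerZ; ring.
Qed.
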